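(* Let $r,s\ge0$ be integers. For every $N\in\mathbb{Z}_{\ge0}$, $$(-1)^{r+s}\frac{Z_{(1^r),(1^s)}(t^N;q,t)}{Z_{\emptyset,\emptyset}(t^N;q,t)}=(-1)^{r+s}g_{1^s}\,g_{1^r}\;e_r\big(\{t^{i-\frac12}\}_{1\le i\le N}\big)\;e_s\big(\{q^{(1^r)_i}t^{N+\frac12-i}\}_{1\le i\le N}\big),$$ where $g_{1^r}:=(-1)^rt^{-r(r-1)/2}$, and $(1^r)_i=1$ for $i\le r$ and $0$ for $i>r$. This is a polynomial in $q$ and $t^{1/2}$ with non-negative integer coefficients, and it vanishes for $0\le N<\max\{r,s\}$.
   Context: A partition $\eta=(\eta_1\ge\eta_2\ge\cdots)$ has size $|\eta|$, conjugate $\eta^\vee$ and length $\ell(\eta)=\eta^\vee_1$; $(i,j)\in\eta$ means $1\le j\le\eta_i$; $(1^r)$ is the partition with $r$ parts equal to $1$; $\emptyset$ is the empty partition. $q,t$ (and $t^{1/2}$) are indeterminates. $e_r(\{y_i\}_{1\le i\le N})$ is the $r$-th elementary symmetric polynomial in the $N$ listed variables ($e_0=1$, $e_r=0$ for $r>N$). Symmetric functions are regarded as polynomials in the power sums $p_n$, and $f(q^\eta t^\rho)$ denotes the value of $f$ when $$p_n\mapsto p_n(q^\eta t^\rho):=\sum_{i=1}^{\ell(\eta)}(q^{n\eta_i}-1)t^{n(\frac12-i)}+\frac{1}{t^{n/2}-t^{-n/2}}.$$ With $s_\lambda$ the Schur function, define the formal power series in $Q$ $$Z_{\lambda,\mu}(Q;q,t):=\sum_\eta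 s_\lambda(q^\eta t^\rho)\,s_\mu(q^\eta t^\rho)\prod_{(i,j)\in\eta}\frac{Q}{(1-q^{\eta_i-j+1}t^{\eta^\vee_j-i})(1-q^{-\eta_i+j}t^{-\eta^\vee_j+i-1})},$$ the sum being over all partitions $\eta$. The ratio $Z_{(1^r),(1^s)}(Q;q,t)/Z_{\emptyset,\emptyset}(Q;q,t)$ is a polynomial in $Q$, and the left-hand side of the claim means the value of this polynomial at $Q=t^N$. *)

(* Defs.v *)
From HB Require Import structures.
From mathcomp Require Import all_boot all_order all_algebra.
From mathcomp Require Import fraction.
From mathcomp Require Import mpoly zify.

Set Implicit Arguments.
Unset Strict Implicit.
Unset Printing Implicit Defensive.

Import Order.TTheory GRing.Theory Num.Theory.

Local Open Scope ring_scope.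

(* A partition is a sequence of naturals in nonincreasing order; trailing     *)
(* zeros are allowed and irrelevant.  Parts and columns are numbered from 1.  *)

Definition part (eta : seq nat) (i : nat) : nat := nth 0%N eta i.-1.

Definition conjpart (eta : seq nat) (j : nat) : nat := count (leq j) eta.

Definition plength (eta : seq nat) : nat := conjpart eta 1.

Definition is_partition_of (n : nat) (eta : seq nat) : bool :=
  sorted geq eta && (sumn eta == n).

(* Every partition of n occurs exactly once among the nonincreasing n-tuples  *)
(* with entries at most n, after padding with zeros up to length n.           *)
Definition parts_of (n : nat) (eta : n.-tuple 'I_n.+1) : seq nat :=
  [seq val i | i <- eta].

Section Schur.

Variable F : fieldType.

(* The complete symmetric functions h_0, ..., h_n as polynomials in the power *)
(* sums p 1, p 2, ..., by Newton's identity                                   *)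
(* n h_n = \sum_(1 <= k <= n) p_k h_(n - k) (lemma hsymS below).              *)
(* The value p 0 is never used.                                               *)
Fixpoint hsym_seq (p : nat -> F) (n : nat) : seq F :=
  if n is m.+1 then
    let h := hsym_seq p m in
    rcons h ((\sum_(k < m.+1) p k.+1 * h`_(m - k)) / m.+1%:R)
  else [:: 1].

Definition hsym (p : nat -> F) (n : nat) : F := (hsym_seq p n)`_n.

(* The value of the Schur function s_lambda, regarded as a polynomial in the  *)
(* power sums, when p_n is given the value p n: the determinant of the        *)
(* h_(lambda_i - i + j), with h_m = 0 for m < 0.  That this is the usual      *)
(* Schur function is schur_bialternant below.                                 *)
Definition schur (p : nat -> F) (lambda : seq nat) : F :=
  \det (\matrix_(i < size lambda, j < size lambda)
          (let m := (nth 0%N lambda i + j)%N in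
           if (i <= m)%N then hsym p (m - i) else 0)).

Lemma size_hsym_seq p n : size (hsym_seq p n) = n.+1.
Proof. by elim: n => //= n IH; rewrite size_rcons IH. Qed.

Lemma nth_hsym_seq p n m : (m <= n)%N -> (hsym_seq p n)`_m = hsym p m.
Proof.
elim: n => [|n IH]; first by rewrite leqn0 => /eqP->.
rewrite leq_eqVlt => /orP[/eqP->//|]; rewrite ltnS => le_mn.
by rewrite /= nth_rcons size_hsym_seq ltnS le_mn IH.
Qed.

Lemma hsym0 p : hsym p 0 = 1. Proof. by []. Qed.

Lemma hsymS p n : [pchar F] =i pred0 ->
  n.+1%:R * hsym p n.+1 = \sum_(k < n.+1) p k.+1 * hsym p (n - k).
Proof.
move=> F0; rewrite /hsym [hsym_seq _ _]/= nth_rcons size_hsym_seq ltnn eqxx.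
rewrite [LHS]mulrC divfK ?((pcharf0P F).1 F0) //.
by apply: eq_bigr => k _; congr (_ * _); exact: nth_hsym_seq (leq_subr _ _).
Qed.

End Schur.

Section Bialternant.

Variables (F : fieldType) (n : nat) (x : 'I_n -> F).
Hypothesis F0 : [pchar F] =i pred0.

Let p (k : nat) : F := \sum_(i < n) x i ^+ k.
Let fac (l : 'I_n) : {poly F} := 1 - x l *: 'X.
Let E : {poly F} := \prod_l fac l.
Let E1 (i : 'I_n) : {poly F} := \prod_(l | l != i) fac l.

Let E_split i : E = E1 i * fac i.
Proof. by rewrite /E (bigD1 i) //= mulrC. Qed.

Let coef_fac (A : {poly F}) l m :
  (A * fac l)`_m = A`_m - (if m is m'.+1 then x l * A`_m' else 0).
Proof.
rewrite mulrBr mulr1 -scalerAr coefB coefZ coefMX.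
by case: m => [|m] //=; rewrite mulr0.
Qed.

Let E1_E i m : (E1 i)`_m = \sum_(k < m.+1) x i ^+ k * E`_(m - k).
Proof.
elim: m => [|m IH].
  by rewrite big_ord1 expr0 mul1r subn0 (E_split i) coef_fac subr0.
rewrite big_ord_recl expr0 mul1r subn0 (E_split i) coef_fac -(E_split i).
rewrite (eq_bigr (fun k : 'I_m.+1 => x i * (x i ^+ k * E`_(m - k))));
  last first.
  by move=> k _; rewrite lift0 subSS exprS mulrA.
by rewrite -mulr_sumr -IH subrK.
Qed.

Let Newton_E m : m.+1%:R * E`_m.+1 = - \sum_(k < m.+1) p k.+1 * E`_(m - k).
Proof.
have dE : E^`() = \sum_i - x i *: E1 i.
  rewrite /E (eq_bigr _ (fun i _ => erefl (fac i))).
  have -> : forall s : seq 'I_n, uniq s -> (\prod_(i <- s) fac i)^`() =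
    \sum_(i <- s) - x i *: \prod_(l <- s | l != i) fac l.
  - elim=> [|a s IH] /=; first by rewrite !big_nil derivC.
    case/andP=> a_s us; rewrite !big_cons eqxx derivM IH //=.
    congr (_ + _).
      rewrite /fac derivB derivC derivZ derivX sub0r alg_polyC -polyCN
        mul_polyC.
      congr (_ *: _); rewrite big_seq_cond [RHS]big_seq_cond.
      apply: eq_bigl => l; case: (boolP (l \in s)) => //= ls.
      by apply/esym; apply: contraNneq a_s => <-.
    rewrite mulr_sumr !big_seq; apply: eq_bigr => i i_s.
    rewrite big_cons; have -> : a != i by apply: contraNneq a_s => ->.
    by rewrite -scalerAr.
  - by [].
  - exact: index_enum_uniq.
rewrite mulr_natl -coef_deriv dE coef_sum.
rewrite (eq_bigr (fun i => - \sum_(k < m.+1) x i ^+ k.+1 * E`_(m - k)));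
  last first.
  move=> i _; rewrite coefZ E1_E mulNr mulr_sumr; congr (- _).
  by apply: eq_bigr => k _; rewrite exprS mulrA.
rewrite sumrN exchange_big /=; congr (- _); apply: eq_bigr => k _.
by rewrite -mulr_suml.
Qed.

Let HE m : \sum_(k < m.+1) hsym p k * E`_(m - k) = (m == 0)%:R.
Proof.
case: m => [|m].
  rewrite big_ord1 hsym0 mul1r -horner_coef0 horner_prod big1 // => l _.
  by rewrite /fac !hornerE ?mulr0 ?subr0.
rewrite /=.
pose H := \poly_(i < m.+2) hsym p i.
pose P := \poly_(i < m.+2) (if i is 0 then 0 else p i).
have Hc k : (k <= m.+1)%N -> H`_k = hsym p k
  by move=> ?; rewrite coef_poly ltnS ifT.
have Pc k : (k <= m)%N -> P`_k.+1 = p k.+1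
  by move=> ?; rewrite coef_poly !ltnS ifT.
have P0 : P`_0 = 0 by rewrite coef_poly.
have XH k : (k <= m.+1)%N -> ('X * H^`())`_k = (P * H)`_k.
  case: k => [|k] le_k; first by rewrite coefXM coefM big_ord1 /= P0 mul0r.
  rewrite coefXM /= coef_deriv -mulr_natl Hc // hsymS //
    coefM [RHS]big_ord_recl P0.
  rewrite mul0r add0r; apply: eq_bigr => j _.
  have lj : (j <= k)%N by rewrite -ltnS.
  rewrite lift0 subSS Pc ?(leq_trans lj) //.
  by rewrite Hc // (leq_trans (leq_subr _ _)) // ltnW.
have XE k : (k <= m.+1)%N -> ('X * E^`())`_k = - (P * E)`_k.
  case: k => [|k] le_k.
    by rewrite coefXM coefM big_ord1 /= P0 mul0r oppr0.
  rewrite coefXM /= coef_deriv -mulr_natl Newton_E coefM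
    [X in _ = - X]big_ord_recl P0.
  rewrite mul0r add0r; congr (- _); apply: eq_bigr => j _.
  have lj : (j <= k)%N by rewrite -ltnS.
  by rewrite lift0 subSS Pc ?(leq_trans lj).
have -> : \sum_(k < m.+2) hsym p k * E`_(m.+1 - k) = (H * E)`_m.+1.
  by rewrite coefM; apply: eq_bigr => k _; rewrite Hc // -ltnS.
have : ('X * (H * E)^`())`_m.+1 = 0.
  have -> : 'X * (H * E)^`() = ('X * H^`()) * E + H * ('X * E^`()).
    by rewrite derivM mulrDr mulrA [H * ('X * _)]mulrCA.
  have eqM (A B C : {poly F}) : (forall k, (k <= m.+1)%N -> A`_k = B`_k) ->
      (A * C)`_m.+1 = (B * C)`_m.+1.
    by move=> AB; rewrite !coefM; apply: eq_bigr => k _; rewrite AB // -ltnS.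
  rewrite coefD (eqM _ _ _ XH) mulrC [H * _]mulrC.
  have XE' k : (k <= m.+1)%N -> ('X * E^`())`_k = (- (P * E))`_k.
    by move=> ?; rewrite XE // coefN.
  rewrite (eqM _ _ _ XE') -coefD.
  suff -> : E * (P * H) + - (P * E) * H = 0 by rewrite coef0.
  by rewrite mulNr mulrCA mulrA subrr.
rewrite coefXM coef_deriv => dHE.
have /eqP : m.+1%:R * (H * E)`_m.+1 = 0 by rewrite mulr_natl.
by rewrite mulf_eq0 ((pcharf0P F).1 F0) /= => /eqP.
Qed.

Let HE1 i m : \sum_(k < m.+1) hsym p (m - k) * (E1 i)`_k = x i ^+ m.
Proof.
pose H := \poly_(i < m.+1) hsym p i.
have HA k : (k <= m)%N -> (H * E)`_k = (k == 0%N)%:R.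
  move=> le_km; rewrite -HE coefM; apply: eq_bigr => j _.
  rewrite coef_poly ifT //.
  by rewrite ltnS (leq_trans _ le_km) // -ltnS.
suff E1m k : (k <= m)%N -> (H * E1 i)`_k = x i ^+ k.
  rewrite -E1m // mulrC coefM; apply: eq_bigr => k _.
  by rewrite coef_poly ltnS leq_subr mulrC.
elim: k => [|k IH] le_k; have := HA _ le_k; rewrite (E_split i) mulrA coef_fac.
  by rewrite subr0.
by rewrite IH ?(ltnW le_k) // -exprS => /eqP; rewrite subr_eq0 => /eqP.
Qed.

Let size_E1 i : (size (E1 i) <= n)%N.
Proof.
have sz (s : seq 'I_n) : (size (\prod_(l <- s) fac l)%R <= (size s).+1)%N.
  elim: s => [|a s IH]; first by rewrite big_nil size_polyC oner_neq0.
  rewrite big_cons (leq_trans (size_polyMleq _ _)) //.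
  have : (size (fac a) <= 2)%N.
    rewrite /fac (leq_trans (size_polyD _ _)) // geq_max size_polyC
      oner_neq0 /=.
    by rewrite size_polyN (leq_trans (size_scale_leq _ _)) // size_polyX.
  by move: IH => /=; lia.
have -> : E1 i = \prod_(l <- enum (predC1 i)) fac l.
  by rewrite big_enum /=; apply: eq_bigl.
by rewrite (leq_trans (sz _)) // -cardE cardC1 card_ord prednK //
  (leq_ltn_trans _ (ltn_ord i)).
Qed.

(* With n variables x_i, p_k = \sum_i x_i^k and lambda padded to n parts,     *)
(* s_lambda is the quotient of alternants                                     *)
(* det(x_i^(lambda_j + n - j)) / det(x_i^(n - j)).                            *)
Lemma schur_bialternant (lambda : seq nat) : size lambda = n ->
  schur p lambda * \det (\matrix_(i < n, j < n) x i ^+ (n - j.+1))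
  = \det (\matrix_(i < n, j < n) x i ^+ (nth 0%N lambda j + (n - j.+1))).
Proof.
move=> szl.
pose JT (mu : nat -> nat) := \matrix_(j < n, k < n)
  (if (j <= mu j + k)%N then hsym p (mu j + k - j) else 0).
pose M := \matrix_(k < n, i < n) (E1 i)`_(n - k.+1).
have key (mu : nat -> nat) :
    \matrix_(i < n, j < n) x i ^+ (mu j + (n - j.+1)) = (JT mu *m M)^T.
  apply/matrixP => i j; rewrite !mxE -HE1 /=.
  under [RHS]eq_bigr do rewrite !mxE.
  pose G k := if (k <= mu j + (n - j.+1))%N
              then hsym p (mu j + (n - j.+1) - k) * (E1 i)`_k else 0.
  have E0 k : (n <= k)%N -> G k = 0.
    move=> le_nk; rewrite /G; case: ifP => // _.
    by rewrite nth_default ?mulr0 // (leq_trans (size_E1 i)).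
  have -> : \sum_(k < (mu j + (n - j.+1)).+1)
      hsym p (mu j + (n - j.+1) - k) * (E1 i)`_k =
      \sum_(k < maxn n (mu j + (n - j.+1)).+1) G k.
    rewrite -(big_mkord xpredT G)
      (big_cat_nat (n := (mu j + (n - j.+1)).+1)) ?leq_maxr //=.
    rewrite [X in _ = _ + X]big_nat_cond [X in _ = _ + X]big1 ?addr0
      => [|k /andP[/andP[lk _] _]].
      by rewrite big_mkord; apply: eq_bigr => k _; rewrite /G -ltnS ltn_ord.
    by rewrite /G leqNgt lk.
  rewrite -(big_mkord xpredT G) (big_cat_nat (n := n)) ?leq_maxl //=.
  rewrite [X in _ + X = _]big_nat_cond [X in _ + X = _]big1 ?addr0; last first.
    by move=> k /andP[/andP[lk _] _]; exact: E0.
  rewrite big_mkord (reindex_inj rev_ord_inj) /=; apply: eq_bigr => k _.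
  have lj := ltn_ord j; have lk := ltn_ord k.
  rewrite /G.
  have -> : (n - k.+1 <= mu j + (n - j.+1))%N = (j <= mu j + k)%N by lia.
  case: ifP => [le|]; last by rewrite mul0r.
  by congr (hsym p _ * _); lia.
have detJT : \det (JT (nth 0%N lambda)) = schur p lambda.
  by rewrite /schur /JT; case: n / szl.
have detJT0 : \det (JT (fun=> 0%N)) = 1.
  rewrite -det_tr det_trig.
    rewrite big1 // => i _; rewrite !mxE add0n leqnn subnn; exact: hsym0.
  apply/is_trig_mxP => i j lt_ij; rewrite !mxE add0n leqNgt lt_ij //.
rewrite (key (nth 0%N lambda)) (key (fun=> 0%N)) !det_tr !det_mulmx.
by rewrite detJT detJT0 mul1r.
Qed.

End Bialternant.

(* The field Q(q, t^(1/2)), as the fraction field of Z[q][t^(1/2)]: q is the  *)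
(* inner variable and t^(1/2) the outer one.                                  *)
Notation Zqt := {poly {poly int}}.
Notation Kqt := {fraction Zqt}.

Definition q : Kqt := FracField.tofrac (('X : {poly int})%:P : Zqt).
Definition sqrt_t : Kqt := FracField.tofrac ('X : Zqt).
Definition t : Kqt := sqrt_t ^+ 2.

(* p_n(q^eta t^rho), where t^(n(1/2 - i)) is written sqrt_t^(n(1 - 2i)).      *)
Definition pspec (eta : seq nat) (n : nat) : Kqt :=
  \sum_(1 <= i < (plength eta).+1)
     (q ^+ (n * part eta i) - 1) * sqrt_t ^ (n%:Z * (1 - 2 * i%:Z))
  + (sqrt_t ^+ n - sqrt_t ^- n)^-1.

Definition Zweight (eta : seq nat) : Kqt :=
  \prod_(1 <= i < (plength eta).+1) \prod_(1 <= j < (part eta i).+1)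
    ((1 - q ^ ((part eta i)%:Z - j%:Z + 1) * t ^ ((conjpart eta j)%:Z - i%:Z)) *
     (1 - q ^ (- (part eta i)%:Z + j%:Z)
            * t ^ (- (conjpart eta j)%:Z + i%:Z - 1)))^-1.

(* A formal power series in Q is given by its sequence of coefficients.  Each *)
(* box of eta contributes one factor Q, so the coefficient of Q^n in          *)
(* Z_(lambda,mu) is the sum over the partitions eta of n.                     *)
Definition Zseries (lambda mu : seq nat) (n : nat) : Kqt :=
  \sum_(eta : n.-tuple 'I_n.+1 | is_partition_of n (parts_of eta))
     schur (pspec (parts_of eta)) lambda * schur (pspec (parts_of eta)) mu
     * Zweight (parts_of eta).

(* The quotient A / B of power series (B having invertible constant term, so  *)
(* that the quotient exists and is unique) is the polynomial P.               *)
Definition fps_quotient_is (F : fieldType) (A B : nat -> F) (P : {poly F}) :=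
  B 0%N != 0 /\ forall n, A n = \sum_(k < n.+1) P`_k * B (n - k)%N.

Definition onecol (r : nat) : seq nat := nseq r 1%N.

Definition g_col (r : nat) : Kqt := (-1) ^+ r * t ^- (r * r.-1)./2.

Definition elem_sym (N r : nat) (y : nat -> Kqt) : Kqt :=
  (mesym N Kqt r).@[fun i : 'I_N => y i.+1].

Definition nonneg_int_poly (z : Kqt) : Prop :=
  exists2 f : Zqt, z = FracField.tofrac f & forall i j, 0 <= f`_i`_j.

(* Main.v *)
(* Write X_i = q^(eta_i) t^(1-i) for the rows of eta and                      *)
(* E_eta(z) = \prod_i (1 - z X_i), whose coefficient of z^r is, up to         *)
(* normalization, (-1)^r e_r(q^eta t^rho).  Let E_i be E_eta without its i-th *)
(* factor.  Lagrange interpolation at the points 1/X_i gives                  *)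
(*   E_eta(t z) = (1 - t z) E_eta(z) + z \sum_i up_i E_i(z),                  *)
(*   E_eta(z / t) = \sum_i down_i E_i(z),                                     *)
(* and the weights of eta and of eta plus a box in row i are related by       *)
(*   w(eta + box_i) up_i(eta + box_i) = t w(eta) down_i(eta),                 *)
(* while up_i = 0 when no box can be removed from row i.  Since E_i does not  *)
(* change when a box is added to row i, summing over all partitions gives     *)
(* first-order recurrences for F_(r,s), the ratio of the sum of               *)
(* w Q^|eta| [z^r] E_eta [z^s] E_eta to the sum of w Q^|eta|:                 *)
(*   (t^(r+1) - 1) F_(r+1,0) = - t (1 - Q t^(-r)) F_(r,0),                    *)
(*   (t^(r+1) - 1) F_(r+1,s) - (t^(s+1) - 1) F_(r,s+1)                        *)
(*     = t q Q (t^(-r) - t^(-s)) F_(r,s).                                     *)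
(* They determine every F_(r,s), show that it is a polynomial in Q, and at    *)
(* Q = t^N they are satisfied by the products of elementary symmetric         *)
(* polynomials, by a q-binomial computation.                                  *)

Require Import Defs.
From mathcomp Require Import all_boot all_order all_algebra.
From mathcomp Require Import fraction mpoly.
From mathcomp Require Import zify ring.

Set Implicit Arguments.
Unset Strict Implicit.
Unset Printing Implicit Defensive.

Import Order.TTheory GRing.Theory Num.Theory.

Local Open Scope ring_scope.

(** Because [s_(1^r)] is elementary ([schur_onecol]), its values at q^eta t^rho are, up to a sign
    and a power of t^(1/2), the coefficients of the infinite product E of the factors 1 - z X_i over
    all rows ([schur_power_spec]). Under z -> t z or z -> z / t the empty rows only move by one
    place, so a finite Lagrange interpolation expresses the dilated product through the products E_i
    with one row omitted ([hcoef_up], [hcoef_down]).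

    These two expansions are linked by a detailed balance ([weight_addbox]): the [up] term at a
    partition with a box added to row i equals t times the [down] term before the addition. As E_i
    ignores row i, a sum of [up] terms over partitions of n + 1 becomes a sum of [down] terms over
    partitions of n ([weighted_sum_box]), which costs one factor Q. One column gives [emoment_colS];
    for two columns an antisymmetric combination is proportional to X_i, so the added box merely
    multiplies it by q ([emoment_commS]).

    To keep sums finite, M rows are explicit and [vac] stands for the others; [weight] is defined on
    all M-tuples and vanishes off partitions, so that adding a box becomes a bijection of tuples,
    and [partition_sum] returns to partitions.

    Since t^k - 1 is invertible for k > 0, the recurrences build the quotient as a polynomial in Q
    ([partition_series_quotient]); at Q = t^N the claimed product obeys the same recurrences
    ([column_value_col], [column_value_step]). Positivity holds because e_r of N variables u_i t^i,
    i >= 0, is divisible by t^(r(r-1)/2), the power in [g_col] ([nonneg_elsym]); vanishing, because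
    e_r of fewer than r variables is 0. *)

(** * Complete symmetric functions through Newton's identity; one-column Schur functions *)

Section Newton.

Variable F : fieldType.
Hypothesis F0 : [pchar F] =i pred0.

(** In characteristic zero Newton's identity can be solved for the next term. The three lemmas below
    each exhibit a candidate and check the identity. *)
Lemma hsym_unique (p f : nat -> F) : f 0%N = 1 ->
  (forall n, n.+1%:R * f n.+1 = \sum_(k < n.+1) p k.+1 * f (n - k)%N) ->
  f =1 hsym p.
Proof.
move=> f0 fS n; elim/ltn_ind: n => -[_|n IH]; first by rewrite f0 hsym0.
apply: (@mulfI _ n.+1%:R); first by rewrite ((pcharf0P F).1 F0).
rewrite fS hsymS //; apply: eq_bigr => k _.
by rewrite IH // ltnS leq_subr.
Qed.

Lemma eq_hsym (p p' : nat -> F) : (forall k, p k.+1 = p' k.+1) ->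
  hsym p =1 hsym p'.
Proof.
move=> pp'; apply: hsym_unique => [|n]; first exact: hsym0.
by rewrite hsymS //; apply: eq_bigr => k _; rewrite pp'.
Qed.

Lemma hsym_scale (c : F) (p : nat -> F) n :
  hsym (fun k => c ^+ k * p k) n = c ^+ n * hsym p n.
Proof.
symmetry; move: n; apply: hsym_unique => [|n].
  by rewrite hsym0 mulr1.
rewrite mulrCA hsymS // mulr_sumr; apply: eq_bigr => k _.
have lk : (k <= n)%N by rewrite -ltnS.
by rewrite mulrACA -exprD addSn subnKC.
Qed.

(** Removing a variable x multiplies the generating series by 1 - x z. *)
Lemma hsym_subX (x : F) (p : nat -> F) n :
  hsym (fun k => p k - x ^+ k) n.+1 = hsym p n.+1 - x * hsym p n.
Proof.
pose f m := if m is m'.+1 then hsym p m - x * hsym p m' else 1.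
rewrite -[RHS]/(f n.+1); symmetry; move: n.+1; apply: hsym_unique => // m.
(* In series: x z / (1 - x z) times (1 - x z) H is x z H. *)
have tele : forall j, \sum_(k < j.+1) x ^+ k.+1 * f (j - k)%N = x * hsym p j.
  elim=> [|j IH]; first by rewrite big_ord1 hsym0.
  rewrite big_ord_recl /= subn0 expr1.
  under eq_bigr => k _ do rewrite /bump /= add1n subSS exprS -mulrA.
  by rewrite -mulr_sumr IH -mulrDr subrK.
under eq_bigr => k _ do rewrite mulrBl.
rewrite sumrB tele /f; case: m => [|m].
  rewrite big_ord1 /= hsym0 !mulr1 mul1r; have := hsymS p 0 F0.
  by rewrite big_ord1 hsym0 mulr1 mul1r => ->.
rewrite mulrBr hsymS // [in RHS]big_ord_recr /= subnn.
under [in RHS]eq_bigr => k _.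
  rewrite (_ : (m.+1 - k)%N = (m - k).+1); last by have := ltn_ord k; lia.
  rewrite mulrBr; over.
rewrite sumrB [in LHS]big_ord_recr /= subnn hsym0.
under [in LHS]eq_bigr => k _.
  rewrite (_ : (m.+1 - k)%N = (m - k).+1); last by have := ltn_ord k; lia.
  over.
under [X in _ = _ - X + _ - _]eq_bigr => k _ do rewrite mulrCA.
by rewrite -mulr_sumr -hsymS // [in LHS]mulrCA -[m.+2]addn1 natrD; ring.
Qed.

(** The series of [p] and of [- p] have opposite logarithmic derivatives, so their product has
    derivative zero. *)
Lemma hsym_inv (p : nat -> F) m :
  \sum_(k < m.+2) hsym p k * hsym (fun j => - p j) (m.+1 - k) = 0.
Proof.
pose ser (u : nat -> F) := \poly_(i < m.+2) u i.
pose P := \poly_(i < m.+2) p i.+1.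
have serE u k : (k <= m.+1)%N -> (ser u)`_k = u k.
  by move=> lk; rewrite coef_poly ltnS lk.
have PE k : (k <= m.+1)%N -> P`_k = p k.+1.
  by move=> lk; rewrite coef_poly ltnS lk.
have dser u k : (k <= m)%N ->
    ((ser (hsym u))^`())`_k = \sum_(j < k.+1) u j.+1 * (ser (hsym u))`_(k - j).
  move=> lk; rewrite coef_deriv serE // -mulr_natl hsymS //.
  by apply: eq_bigr => j _; rewrite serE //; lia.
set A := ser (hsym p); set B := ser (hsym (fun j => - p j)).
have eqM (C D E : {poly F}) : (forall k, (k <= m)%N -> C`_k = D`_k) ->
    (C * E)`_m = (D * E)`_m.
  by move=> CD; rewrite !coefM; apply: eq_bigr => k _; rewrite CD // -ltnS.
have dA k : (k <= m)%N -> (A^`())`_k = (P * A)`_k.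
  move=> lk; rewrite dser // coefM; apply: eq_bigr => j _.
  by rewrite PE //; have := ltn_ord j; lia.
have dB k : (k <= m)%N -> (B^`())`_k = (- (P * B))`_k.
  move=> lk; rewrite dser // coefN coefM -sumrN; apply: eq_bigr => j _.
  by rewrite mulNr PE //; have := ltn_ord j; lia.
have : ((A * B)^`())`_m = 0.
  rewrite derivM coefD (eqM _ _ _ dA) [A * _]mulrC (eqM _ _ _ dB) -coefD.
  by rewrite mulNr mulrAC subrr coef0.
rewrite coef_deriv -mulr_natl => /eqP.
rewrite mulf_eq0 ((pcharf0P F).1 F0) /= => /eqP {2}<-.
rewrite coefM; apply: eq_bigr => k _; have lk := ltn_ord k.
by rewrite !serE // leq_subr.
Qed.

Lemma schurE (p : nat -> F) (lambda : seq nat) n : size lambda = n ->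
  schur p lambda = \det (\matrix_(i < n, j < n)
    (if (i <= nth 0%N lambda i + j)%N then hsym p (nth 0%N lambda i + j - i)
     else 0)).
Proof. by move=> <-. Qed.

(* Multiplying the Jacobi-Trudi matrix on the right by the unitriangular      *)
(* Toeplitz matrix of the inverse series leaves a companion matrix.           *)
Lemma schur_onecol (p : nat -> F) r :
  schur p (onecol r) = (-1) ^+ r * hsym (fun k => - p k) r.
Proof.
rewrite (schurE _ (size_nseq r 1%N)); case: r => [|r].
  by rewrite det_mx00 hsym0 mulr1.
set e := hsym (fun k => - p k).
set A := \matrix_(i, j) _.
pose U := \matrix_(i < r.+1, j < r.+1) (if (i <= j)%N then e (j - i)%N else 0).
have detU : \det U = 1.
  rewrite -det_tr det_trig.
    by rewrite big1 // => i _; rewrite !mxE leqnn subnn /e hsym0.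
  by apply/is_trig_mxP => i j lt_ij; rewrite !mxE leqNgt lt_ij.
have AU : A *m U = \matrix_(i < r.+1, j < r.+1)
    (if i == ord0 then - e j.+1 else (i == j.+1 :> nat)%:R).
  apply/matrixP => i j; rewrite !mxE.
  pose G k := if (k <= j)%N && (i <= k.+1)%N then
      hsym p (k.+1 - i) * e (j - k)%N else 0.
  have -> : \sum_k A i k * U k j = \sum_(0 <= k < j.+1) G k.
    transitivity (\sum_(0 <= k < r.+1) G k).
      rewrite big_mkord; apply: eq_bigr => k _; rewrite !mxE /G nth_nseq ltn_ord.
      by rewrite add1n; do !case: ifP => //=; rewrite ?mulr0 ?mul0r.
    rewrite (big_cat_nat (n := j.+1)) //= [X in _ + X]big_nat_cond.
    rewrite [X in _ + X]big1 ?addr0 // => k /andP[/andP[lk _] _].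
    by rewrite /G leqNgt lk.
  have [i0|i0] := eqVneq i ord0.
    have := hsym_inv p j; rewrite big_ord_recl hsym0 mul1r subn0 => /eqP.
    rewrite addrC addr_eq0 => /eqP <-; rewrite big_mkord; apply: eq_bigr => k _.
    by rewrite /G i0 -ltnS ltn_ord /= /bump /= add1n subSS subn0.
  have i_gt0 : (0 < i)%N by rewrite lt0n.
  have [lt_ji|le_ij] := ltnP j.+1 i.
    rewrite gtn_eqF // big_nat_cond big1 // => k /andP[/andP[_ lk] _].
    by rewrite /G ltnS in lk *; case: ifP => // /andP[]; lia.
  rewrite (big_cat_nat (n := i.-1)) //=; last exact: leq_trans (leq_pred _) _.
  rewrite big_nat_cond big1 => [|k /andP[/andP[_ lk] _]]; last first.
    by rewrite /G; case: ifP => // /andP[]; lia.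
  rewrite add0r -{1}[i.-1]add0n big_addn big_mkord.
  have -> : (j.+1 - i.-1 = (j.+1 - i).+1)%N by lia.
  have [ij|ne] := eqVneq (i : nat) j.+1.
    rewrite /G ij subnn big_ord1 /= add0n !leqnn /= !subnn.
    by rewrite hsym0 /e hsym0 mulr1.
  have -> : (j.+1 - i = (j.+1 - i).-1.+1)%N by lia.
  rewrite -[RHS](hsym_inv p (j.+1 - i).-1); apply: eq_bigr => k _.
  have lk := ltn_ord k; rewrite /G ifT; last by lia.
  by congr (hsym _ _ * e _); lia.
have -> : \det A = \det (A *m U) by rewrite det_mulmx detU mulr1.
(* The last column has only its top entry [- e r.+1], and the complementary minor is an identity
   matrix. *)
rewrite AU (expand_det_col _ ord_max) big_ord_recl big1 => [|i _]; last first.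
  rewrite !mxE /= (ltn_eqF _) ?mul0r // /bump /= add1n ltnS.
  exact: ltn_ord.
rewrite addr0 !mxE eqxx /cofactor /= add0n.
rewrite [X in \det X](_ : _ = 1%:M) ?det1; first by rewrite exprS; ring.
apply/matrixP => i j; rewrite !mxE /= /bump /= add1n.
have lj : (j < r)%N := ltn_ord j.
by rewrite leqNgt lj /= add0n eqSS.
Qed.

End Newton.

(** * Interpolation by products with one factor omitted *)

Section Lagrange.

Variable F : fieldType.

Definition fac (x : F) : {poly F} := 1 - x *: 'X.

Lemma horner_fac x z : (fac x).[z] = 1 - x * z.
Proof. by rewrite /fac !hornerE. Qed.

Lemma coef0_fac x (f : {poly F}) : (fac x * f)`_0 = f`_0.
Proof. by rewrite mulrBl mul1r -scalerAl coefB coefZ coefXM mulr0 subr0. Qed.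

Lemma coefS_fac x (f : {poly F}) k : (fac x * f)`_k.+1 = f`_k.+1 - x * f`_k.
Proof. by rewrite mulrBl mul1r -scalerAl coefB coefZ coefXM. Qed.

Lemma size_fac_mul x (f : {poly F}) : (size (fac x * f)%R <= (size f).+1)%N.
Proof.
apply/leq_sizeP => -[|k] // le_k.
by rewrite coefS_fac !nth_default ?mulr0 ?subr0 // leqW.
Qed.

Lemma size_prod_fac (I : Type) (s : seq I) (P : pred I) (x : I -> F) :
  (size (\prod_(i <- s | P i) fac (x i))%R <= (count P s).+1)%N.
Proof.
elim: s => [|i s IH]; first by rewrite big_nil size_poly1.
rewrite big_cons /=; case: ifP => //= _.
by apply: leq_trans (size_fac_mul _ _) _; rewrite add1n ltnS.
Qed.

Variables (M : nat) (x : 'I_M -> F).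
Hypotheses (x_inj : injective x) (x_neq0 : forall i, x i != 0).

Definition allfac : {poly F} := \prod_i fac (x i).
Definition facbut (i : 'I_M) : {poly F} := \prod_(j | j != i) fac (x j).

Lemma allfac_split i : allfac = fac (x i) * facbut i.
Proof. by rewrite /allfac (bigD1 i). Qed.

Lemma size_allfac : (size allfac <= M.+1)%N.
Proof.
apply: leq_trans (size_prod_fac _ _ _) _.
by rewrite ltnS -sum1_count sum1_card card_ord.
Qed.

Lemma size_facbut i : (size (facbut i) <= M)%N.
Proof.
apply: leq_trans (size_prod_fac _ _ _) _.
rewrite -sum1_count sum1_card cardC1 card_ord.
by rewrite prednK // (leq_ltn_trans _ (ltn_ord i)).
Qed.

Lemma horner_facbut i z : (facbut i).[z] = \prod_(j | j != i) (1 - x j * z).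
Proof. by rewrite horner_prod; apply: eq_bigr => j _; rewrite horner_fac. Qed.

Lemma horner_allfac z : allfac.[z] = \prod_j (1 - x j * z).
Proof. by rewrite horner_prod; apply: eq_bigr => j _; rewrite horner_fac. Qed.

Lemma facbut_neq0 i : (facbut i).[(x i)^-1] != 0.
Proof.
rewrite horner_facbut; apply/prodf_neq0 => j ne_ji.
rewrite subr_eq0 eq_sym -(inj_eq (mulIf (x_neq0 i))) divfK // mul1r.
by rewrite (inj_eq x_inj).
Qed.

(** [facbut i] vanishes at every node except its own, so the difference of the two sides has M
    distinct roots and size at most M. *)
Lemma facbut_interpolation (S : {poly F}) : (size S <= M)%N ->
  S = \sum_i (S.[(x i)^-1] / (facbut i).[(x i)^-1]) *: facbut i.
Proof.
move=> szS; apply/eqP; rewrite -subr_eq0; apply/eqP.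
set D := (X in X = 0).
have szD : (size D <= M)%N.
  rewrite (leq_trans (size_polyD _ _)) // geq_max szS size_polyN.
  apply: leq_trans (size_sum _ _ _) _; apply/bigmax_leqP => i _.
  by rewrite (leq_trans (size_scale_leq _ _)) // size_facbut.
apply: (@roots_geq_poly_eq0 _ _ [seq (x i)^-1 | i <- enum 'I_M]).
- apply/allP => _ /mapP[i _ ->]; rewrite rootE /D hornerD hornerN horner_sum.
  rewrite (bigD1 i) //= hornerZ divfK ?facbut_neq0 // big1 ?addr0 ?subrr //.
  move=> j ne_ji; rewrite hornerZ [X in _ * X]horner_facbut (bigD1 i) 1?eq_sym //=.
  by rewrite divff // subrr mul0r mulr0.
- rewrite map_inj_uniq ?enum_uniq // => i j /(congr1 GRing.inv).
  by rewrite !invrK => /x_inj.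
- by rewrite size_map size_enum_ord.
Qed.

End Lagrange.

(** * Coefficients of a polynomial times an infinite product *)

Section Pairing.

Variable F : fieldType.
Hypothesis F0 : [pchar F] =i pred0.

(* The coefficient of z^r in f(z) H(z), where H is the generating series of   *)
(* the complete symmetric functions at the power sums p.                      *)
Definition hcoef (p : nat -> F) (r : nat) (f : {poly F}) : F :=
  \sum_(k < r.+1) f`_k * hsym p (r - k).

Lemma hcoefD p r f g : hcoef p r (f + g) = hcoef p r f + hcoef p r g.
Proof. by rewrite -big_split; apply: eq_bigr => k _; rewrite coefD mulrDl. Qed.

Lemma hcoefZ p r a f : hcoef p r (a *: f) = a * hcoef p r f.
Proof. by rewrite mulr_sumr; apply: eq_bigr => k _; rewrite coefZ mulrA. Qed.

Lemma hcoef_sum p r (I : finType) (f : I -> {poly F}) :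
  hcoef p r (\sum_i f i) = \sum_i hcoef p r (f i).
Proof.
rewrite exchange_big; apply: eq_bigr => k _ /=.
by rewrite coef_sum mulr_suml.
Qed.

Lemma hcoefMX p r f : hcoef p r.+1 ('X * f) = hcoef p r f.
Proof.
rewrite /hcoef big_ord_recl coefXM mul0r add0r; apply: eq_bigr => k _.
by rewrite coefXM /= /bump /= add1n subSS.
Qed.

Lemma hcoef1 p r : hcoef p r 1 = hsym p r.
Proof.
rewrite /hcoef big_ord_recl coef1 mul1r subn0 big1 ?addr0 // => k _.
by rewrite coef1 mul0r.
Qed.

(** A factor 1 - x z can be moved from the polynomial into the series, where it removes x from the
    power sums. *)
Lemma hcoef_fac p x r f :
  hcoef p r (fac x * f) = hcoef (fun k => p k - x ^+ k) r f.
Proof.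
case: r => [|r]; first by rewrite /hcoef !big_ord1 coef0_fac !hsym0.
rewrite mulrBl mul1r -scalerAl -scaleNr hcoefD hcoefZ hcoefMX /hcoef.
rewrite !(big_ord_recr r.+1) /= subnn !hsym0 addrAC mulr_sumr -big_split /=.
congr (_ + _); apply: eq_bigr => k _; rewrite subSn -1?ltnS // hsym_subX //.
by ring.
Qed.

Lemma hcoef_allfac p M (x : 'I_M -> F) r :
  hcoef p r (allfac x) = hsym (fun k => p k - \sum_i x i ^+ k) r.
Proof.
rewrite /allfac; elim: (index_enum _) p => [|i s IH] p.
  by rewrite big_nil hcoef1; apply: eq_hsym => // k; rewrite big_nil subr0.
rewrite big_cons hcoef_fac IH; apply: eq_hsym => // k.
by rewrite big_cons opprD addrA.
Qed.

Lemma hcoef_facbut p M (x : 'I_M -> F) i r :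
  hcoef p r.+1 (facbut x i) =
  hcoef p r.+1 (allfac x) + x i * hcoef p r (facbut x i).
Proof.
by rewrite (allfac_split x i) mulrBl mul1r -scalerAl -scaleNr hcoefD hcoefZ hcoefMX
           mulNr addrNK.
Qed.

Lemma hcoef_facbut0 p M (x : 'I_M -> F) i :
  hcoef p 0 (facbut x i) = hcoef p 0 (allfac x).
Proof. by rewrite (allfac_split x i) /hcoef !big_ord1 coef0_fac. Qed.

End Pairing.

(** * Dilation of the infinite product, with the empty rows as a tail *)

Section Rows.

Variables (F : fieldType) (t : F).
Hypotheses (F0 : [pchar F] =i pred0) (t_neq0 : t != 0).
Hypothesis t_gen : forall k, t ^+ k.+1 != 1.

(* The power sums of the infinitely many empty rows below the first M ones,   *)
(* with the opposite sign: \sum_(i >= M) t^(-i k) as a geometric series.      *)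
Definition vac (M k : nat) : F := - ((t ^- M) ^+ k / (1 - t ^- k)).

(** The tail is the product of 1 - t^(-i) z over i >= M; replacing z by t z adds the factor of i = M
    - 1. *)
Lemma vac_shift M k : t ^+ k.+1 * vac M k.+1 = vac M k.+1 - (t * t ^- M) ^+ k.+1.
Proof.
have := t_gen k; have := expf_neq0 k.+1 t_neq0.
rewrite /vac exprMn; set u := t ^+ k.+1; set v := (t ^- M) ^+ k.+1 => u0 u1.
by field; rewrite u0 subr_eq0 u1.
Qed.

Definition dil (c : F) (f : {poly F}) : {poly F} := f \Po (c *: 'X).

Lemma coef_dil c f k : (dil c f)`_k = c ^+ k * f`_k.
Proof.
rewrite /dil comp_polyE coef_sum.
under eq_bigr => i _ do rewrite exprZn coefZ coefZ coefXn.
case: (ltnP k (size f)) => [lk|le].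
  rewrite (bigD1 (Ordinal lk)) //= eqxx mulr1 mulrC big1 ?addr0 // => i.
  by rewrite -val_eqE /= eq_sym => /negbTE->; rewrite !mulr0.
rewrite nth_default // mulr0 big1 // => i _.
by rewrite gtn_eqF ?mulr0 // (leq_trans (ltn_ord i)).
Qed.

Lemma size_dil c f : (size (dil c f) <= size f)%N.
Proof.
by apply/leq_sizeP => k le_k; rewrite coef_dil nth_default // mulr0.
Qed.

Lemma horner_dil c f z : (dil c f).[z] = f.[c * z].
Proof. by rewrite horner_comp !hornerE. Qed.

Lemma hcoef_vac_shift M r f :
  hcoef (vac M) r (fac (t * t ^- M) * dil t f) = t ^+ r * hcoef (vac M) r f.
Proof.
rewrite hcoef_fac // mulr_sumr; apply: eq_bigr => k _.
rewrite coef_dil (@eq_hsym _ F0 _ (fun k => t ^+ k * vac M k)) => [|j].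
  have lk : (k <= r)%N by rewrite -ltnS.
  have -> : t ^+ r = t ^+ k * t ^+ (r - k) by rewrite -exprD subnKC.
  by rewrite hsym_scale //; ring.
by rewrite vac_shift.
Qed.

Variables (M : nat) (x : 'I_M -> F).
Hypotheses (x_inj : injective x) (x_neq0 : forall i, x i != 0).

(** The Lagrange coefficient of z E_i in E(t z) - (1 - t z) E(z), tail divided out; the factor with
    [t * t ^- M] is the one gained by the tail. *)
Definition up_coef (i : 'I_M) : F :=
  x i * (1 - t * t ^- M / x i) * (\prod_j (1 - t * x j / x i))
  / \prod_(j | j != i) (1 - x j / x i).

(** The analogue for E(z / t); the denominator with [t ^- M] cancels the factor of an empty last
    row. *)
Definition down_coef (i : 'I_M) : F :=
  (\prod_j (1 - x j / (t * x i))) / (1 - t ^- M / x i)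
  / \prod_(j | j != i) (1 - x j / x i).

Lemma hcoef_up r :
  (t ^+ r.+1 - 1) * hcoef (vac M) r.+1 (allfac x) =
  - t * hcoef (vac M) r (allfac x)
  + \sum_i up_coef i * hcoef (vac M) r (facbut x i).
Proof.
pose R : {poly F} :=
  fac (t * t ^- M) * dil t (allfac x) - fac t * allfac x.
pose S : {poly F} := \poly_(k < M) R`_k.+1.
have RS : R = 'X * S.
  apply/polyP => -[|k]; rewrite coefXM /=.
    by rewrite coefB !coef0_fac coef_dil expr0 mul1r subrr.
  rewrite coef_poly; case: ltnP => // le_Mk.
  rewrite coefB !coefS_fac !coef_dil ![(allfac x)`_k.+1]nth_default; last first.
    by rewrite (leq_trans (size_allfac x)).
  (* In degree M + 1 both terms of [R] equal [- t] times the coefficient of z^M in [allfac x], so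
     [S] is small enough to interpolate. *)
  rewrite mulr0 !sub0r opprK; move: le_Mk; rewrite leq_eqVlt => /orP[/eqP<-|lt].
    by rewrite mulrA mulfVK ?expf_neq0 // addNr.
  by rewrite nth_default ?mulr0 ?oppr0 ?addr0 // (leq_trans (size_allfac x)).
have S_up i : S.[(x i)^-1] / (facbut x i).[(x i)^-1] = up_coef i.
  have : R.[(x i)^-1] = (x i)^-1 * S.[(x i)^-1] by rewrite RS hornerM hornerX.
  move=> /(congr1 (fun z => x i * z)); rewrite mulVKf // => <-.
  rewrite /up_coef horner_facbut; congr (_ / _).
  rewrite /R hornerD hornerN !hornerM !horner_fac horner_dil !horner_allfac.
  rewrite [X in _ - _ * X](bigD1 i) //= divff // subrr mul0r mulr0 subr0.
  by rewrite mulrA; congr (_ * _); apply: eq_bigr => j _; rewrite mulrA [x j * t]mulrC.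
have szS : (size S <= M)%N by apply: size_poly.
have SE : S = \sum_i up_coef i *: facbut x i.
  by rewrite (facbut_interpolation x_inj x_neq0 szS); apply: eq_bigr => i _; rewrite S_up.
have : hcoef (vac M) r.+1 R = \sum_i up_coef i * hcoef (vac M) r (facbut x i).
  rewrite RS hcoefMX SE hcoef_sum; apply: eq_bigr => i _.
  by rewrite hcoefZ.
rewrite /R -scaleN1r hcoefD hcoefZ hcoef_vac_shift // mulrBl mul1r -scalerAl.
rewrite -scaleNr hcoefD hcoefZ hcoefMX => <-.
by ring.
Qed.

(** The hypothesis says that [x i0] is t^(1-M), the variable of an empty last row. Its factor is
    absorbed by the shift of the tail, leaving a polynomial of degree below M to interpolate. *)
Lemma hcoef_down r (i0 : 'I_M) : t * x i0 = t * t ^- M * t ->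
  (forall i, 1 - t ^- M / x i != 0) ->
  hcoef (vac M) r (allfac x) =
  t ^+ r * \sum_i down_coef i * hcoef (vac M) r (facbut x i).
Proof.
move=> xi0 nz; have {}xi0 : x i0 = t * t ^- M.
  by apply: (mulfI t_neq0); rewrite xi0 mulrC.
pose G : {poly F} := dil t^-1 (facbut x i0).
have -> : allfac x = fac (t * t ^- M) * dil t G.
  rewrite (allfac_split x i0) xi0; congr (_ * _); apply/polyP => k.
  by rewrite !coef_dil mulrA -exprMn mulfV // expr1n mul1r.
rewrite hcoef_vac_shift; congr (_ * _).
have szG : (size G <= M)%N by rewrite (leq_trans (size_dil _ _)) // size_facbut.
rewrite {1}(facbut_interpolation x_inj x_neq0 szG) hcoef_sum; apply: eq_bigr => i _.
rewrite hcoefZ; congr (_ * _); rewrite horner_facbut /down_coef.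
congr (_ / _); rewrite (bigD1 i0) //= xi0 horner_dil horner_facbut.
rewrite [1 - t * _ / _](_ : _ = 1 - t ^- M / x i); last first.
  by field; rewrite x_neq0 t_neq0 expf_neq0.
rewrite [RHS]mulrAC divff // mul1r; apply: eq_bigr => j _.
by rewrite invfM mulrA.
Qed.

End Rows.

(** * The weight of a tuple of rows and its change when a box is added *)

Section Weight.

Variables (F : fieldType) (q t : F).
Hypotheses (q_neq0 : q != 0) (t_neq0 : t != 0).
Hypothesis qt_gen : forall a b : int, q ^ a * t ^ b = 1 -> a = 0 /\ b = 0.

Definition wfac (a b : int) : F := 1 - q ^ a * t ^ b.

Lemma wfac_neq0 a b : (a != 0) || (b != 0) -> wfac a b != 0.
Proof.
apply: contraTN; rewrite subr_eq0 eq_sym => /eqP /qt_gen[-> ->].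
by rewrite eqxx.
Qed.

Lemma wfacN a b : wfac (- a) (- b) = - (q ^ a * t ^ b)^-1 * wfac a b.
Proof.
rewrite /wfac -!invr_expz; field.
by rewrite !expfz_neq0.
Qed.

(* The denominators of the first n boxes of a row of length m, at leg l.      *)
Definition rowfac (l m n : nat) : F :=
  \prod_(j < n) (wfac (m%:Z - j%:Z) l%:Z * wfac (j.+1%:Z - m%:Z) (- l.+1%:Z)).

Lemma rowfac0 l m : rowfac l m 0 = 1. Proof. exact: big_ord0. Qed.

Lemma rowfacS l m n : rowfac l m n.+1 =
  rowfac l m n * (wfac (m%:Z - n%:Z) l%:Z * wfac (n.+1%:Z - m%:Z) (- l.+1%:Z)).
Proof. exact: big_ord_recr. Qed.

(** Lengthening the row shifts the factors by one column, so only the end factors differ; the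
    cross-multiplied form needs no nonvanishing. *)
Lemma rowfac_addrow l m n :
  rowfac l m.+1 n * (wfac (m.+1%:Z - n%:Z) l%:Z * wfac (n%:Z - m%:Z) (- l.+1%:Z))
  = rowfac l m n * (wfac m.+1%:Z l%:Z * wfac (- m%:Z) (- l.+1%:Z)).
Proof.
elim: n => [|n IH]; first by rewrite !rowfac0 subr0 sub0r.
rewrite !rowfacS.
have -> : m.+1%:Z - n.+1%:Z = m%:Z - n%:Z :> int by lia.
have -> : n.+1%:Z - m.+1%:Z = n%:Z - m%:Z :> int by lia.
by rewrite IH mulrAC.
Qed.

Lemma rowfac_neq0 l m n : (0 < l)%N || (n <= m)%N -> rowfac l m n != 0.
Proof.
move=> lmn; apply/prodf_neq0 => j _; have lj := ltn_ord j.
rewrite mulf_neq0 // wfac_neq0 //; last by rewrite orbC.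
case/orP: lmn => [l0|le]; first by apply/orP; right; lia.
by apply/orP; left; lia.
Qed.

Lemma rowfac_eq0 m n : (m < n)%N -> rowfac 0 m n = 0.
Proof.
move=> lt_mn; rewrite /rowfac (bigD1 (Ordinal lt_mn)) //=.
by rewrite subrr /wfac !expr0z mulr1 subrr !mul0r.
Qed.

(** In row i, the columns ending exactly at row k have leg k - i and contribute a quotient of two
    [rowfac], at the lengths of rows k and k + 1. Regrouping these quotients by row length gives one
    term for each pair of rows. *)
Definition wpair (i j m n : nat) : F :=
  if (i < j)%N then rowfac (j - i).-1 m n / rowfac (j - i) m n
  else if i == j then (rowfac 0 m m)^-1 else 1.

Lemma wpair_gt i j m n : (j < i)%N -> wpair i j m n = 1.
Proof. by move=> lt_ji; rewrite /wpair ltnNge ltnW //= gtn_eqF. Qed.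

Variable M : nat.
Implicit Types (f : {ffun 'I_M -> nat}) (i j a b : 'I_M).

(* The localization weight of a tuple of M rows; unlike the product over      *)
(* boxes it makes sense for every tuple, and it vanishes off partitions.      *)
Definition weight f : F := \prod_(i < M) \prod_(j < M) wpair i j (f i) (f j).

Definition rowvar f i : F := q ^+ f i * t ^- i.

Lemma rowvarE f i : rowvar f i = q ^ (f i)%:Z * t ^ (- i%:Z).
Proof. by rewrite /rowvar exprnN. Qed.

Lemma rowvar_neq0 f i : rowvar f i != 0.
Proof. by rewrite mulf_neq0 ?invr_neq0 ?expf_neq0. Qed.

Lemma rowvar_ratio f i j :
  rowvar f j / rowvar f i = q ^ ((f j)%:Z - (f i)%:Z) * t ^ (i%:Z - j%:Z).
Proof.
rewrite !rowvarE invfM !invr_expz opprK mulrACA -!expfzDr //.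
by rewrite [in t ^ _]addrC.
Qed.

Lemma rowvar_inj f : injective (rowvar f).
Proof.
move=> i j /(congr1 (fun z => z / rowvar f j)); rewrite divff ?rowvar_neq0 //.
by rewrite rowvar_ratio => /qt_gen[_ ij]; apply/val_inj => /=; lia.
Qed.

Lemma vac_rowvar_neq0 f i : 1 - t ^- M / rowvar f i != 0.
Proof.
rewrite exprnN rowvarE invfM !invr_expz opprK mulrCA -expfzDr //.
by have lt_iM := ltn_ord i; apply: wfac_neq0; apply/orP; right; lia.
Qed.

(** The numerator of the pair has leg 0 and runs past the end of row i, where it meets 1 - q^0
    t^0. *)
Lemma weight_eq0 f i j : j = i.+1 :> nat -> (f i < f j)%N -> weight f = 0.
Proof.
move=> ij lt_f; rewrite /weight (bigD1 i) //= (bigD1 j) //= /wpair ij ltnSn.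
by rewrite subSnn /= rowfac_eq0 // !mul0r.
Qed.

Lemma weight_noninc f i j : weight f != 0 -> (i <= j)%N -> (f j <= f i)%N.
Proof.
move=> wf; move: {2}(nat_of_ord j) (leqnn j) => n.
elim: n j => [|n IH] j le_j le_ij.
  by rewrite (_ : i = j) //; apply/val_inj => /=; lia.
have [->//|ne] := eqVneq i j; have {ne} lt_ij : (i < j)%N.
  by rewrite ltn_neqAle le_ij andbT.
have lt_j1 : (j.-1 < M)%N by apply: leq_ltn_trans (leq_pred j) (ltn_ord j).
apply: (@leq_trans (f (Ordinal lt_j1))); last by apply: IH => /=; lia.
by rewrite leqNgt; apply: contra wf => lt; rewrite (@weight_eq0 _ _ _ _ lt) //=; lia.
Qed.

(** If the next row is nonempty the weight vanishes; if it is empty its variable is that of row i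
    divided by t; if there is none, the tail factor vanishes. *)
Lemma up_coef_eq0 f i : f i = 0%N -> weight f * up_coef t (rowvar f) i = 0.
Proof.
move=> fi0; rewrite /up_coef.
have [lt_iM|le_Mi] := ltnP i.+1 M.
  pose j := Ordinal lt_iM.
  have [fj0|fj_gt0] := posnP (f j); last first.
    by rewrite (@weight_eq0 f i j) ?fi0 // mul0r.
  have t_ij : t * rowvar f j / rowvar f i = 1.
    rewrite -mulrA rowvar_ratio fi0 fj0 subrr expr0z mul1r -[t in t * _]expr1z.
    by rewrite -expfzDr // (_ : 1 + _ = 0 :> int) ?expr0z //=; lia.
  by rewrite (bigD1 j) //= t_ij subrr mul0r mulr0 mul0r mulr0.
have Mi : M = i.+1 by apply/eqP; rewrite eqn_leq le_Mi ltn_ord.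
have -> : t * t ^- M / rowvar f i = 1.
  rewrite /rowvar fi0 mul1r invrK [in t ^- M]Mi exprS; field.
  by rewrite expf_neq0 // t_neq0.
by rewrite subrr mulr0 !mul0r mulr0.
Qed.

Definition addbox f i : {ffun 'I_M -> nat} := [ffun j => (f j + (j == i))%N].

Let weight_split f i : weight f =
  wpair i i (f i) (f i)
  * (\prod_(a | a != i) (wpair i a (f i) (f a) * wpair a i (f a) (f i)))
  * \prod_(a | a != i) \prod_(b | b != i) wpair a b (f a) (f b).
Proof.
rewrite /weight (bigD1 i) //= (bigD1 i) //= -!mulrA; congr (_ * _).
rewrite big_split /= -mulrA; congr (_ * _); rewrite -big_split /=.
by apply: eq_bigr => a ai; rewrite (bigD1 i).
Qed.

Let mul_exprz (x : F) (e : int) : x != 0 -> x * x ^ e = x ^ (1 + e).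
Proof. by move=> x_neq0; rewrite expfzDr // expr1z. Qed.

Let ratiofac (l m : nat) : F :=
  wfac m.+1%:Z l%:Z * wfac (- m%:Z) (- l.+1%:Z).

Let ratiofac_neq0 l m : ratiofac l m != 0.
Proof. by rewrite mulf_neq0 // wfac_neq0 // orbC. Qed.

(** Here the row length grows, so [rowfac_addrow] applies at two consecutive legs; the leftover
    quotient of [ratiofac] telescopes over a. *)
Let pair_above f i a (x' := q * rowvar f i) (l := (a - i)%N) :
  (i < a)%N ->
  wpair i a (f i).+1 (f a)
    * ((1 - t * rowvar f a / x') / (1 - rowvar f a / x'))
  = wpair i a (f i) (f a)
    * ((1 - rowvar f a / (t * rowvar f i)) / (1 - rowvar f a / rowvar f i))
    * (t * (ratiofac l.-1 (f i) / ratiofac l (f i))).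
Proof.
move=> lt_ia; rewrite /wpair lt_ia -/l.
have [l' ll'] : exists l', l = l'.+1 by exists l.-1; rewrite /l; lia.
rewrite ll' /=; set m := f i; set n := f a.
have ratio1 : rowvar f a / rowvar f i = q ^ (n%:Z - m%:Z) * t ^ (- l'.+1%:Z).
  rewrite rowvar_ratio; congr (_ * t ^ _); lia.
have -> : 1 - rowvar f a / rowvar f i = wfac (n%:Z - m%:Z) (- l'.+1%:Z).
  by rewrite ratio1.
have -> : 1 - rowvar f a / (t * rowvar f i) = wfac (n%:Z - m%:Z) (- l'.+2%:Z).
  rewrite /wfac invfM mulrCA ratio1 mulrCA -[t^-1]/(t ^ (-1)) -(expfzDr _ _ t_neq0).
  by congr (1 - _ * t ^ _); lia.
have ratio2 : rowvar f a / x' = q ^ (n%:Z - m.+1%:Z) * t ^ (- l'.+1%:Z).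
  rewrite invfM mulrCA ratio1 mulrA -[q^-1]/(q ^ (-1)) -(expfzDr _ _ q_neq0).
  by congr (q ^ _ * _); lia.
have -> : 1 - rowvar f a / x' = wfac (n%:Z - m.+1%:Z) (- l'.+1%:Z).
  by rewrite ratio2.
have -> : 1 - t * rowvar f a / x' = wfac (n%:Z - m.+1%:Z) (- l'%:Z).
  rewrite /wfac -mulrA ratio2 mulrCA (mul_exprz _ t_neq0).
  by congr (1 - _ * t ^ _); lia.
rewrite -[n%:Z - m.+1%:Z]opprB !wfacN.
have := rowfac_addrow l' m n; have := rowfac_addrow l'.+1 m n.
rewrite -/(ratiofac l' m) -/(ratiofac l'.+1 m).
have := ratiofac_neq0 l'.+1 m.
have := @rowfac_neq0 l'.+1 m n isT; have := @rowfac_neq0 l'.+1 m.+1 n isT.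
have : wfac (n%:Z - m%:Z) (- l'.+1%:Z) != 0 by rewrite wfac_neq0 // orbC.
have : wfac (n%:Z - m%:Z) (- l'.+2%:Z) != 0 by rewrite wfac_neq0 // orbC.
have : wfac (m.+1%:Z - n%:Z) l'.+1%:Z != 0 by rewrite wfac_neq0 // orbC.
have -> : t ^ l'.+1%:Z = t * t ^ l'%:Z by rewrite -exprnP exprS.
have : q ^ (m.+1%:Z - n%:Z) != 0 by rewrite expfz_neq0.
have : t ^ l'%:Z != 0 by rewrite expfz_neq0.
set u := t ^ _; set v := q ^ _.
set b1 := wfac _ l'.+1%:Z; set b2 := wfac _ (- l'.+2%:Z).
set b3 := wfac _ (- l'.+1%:Z); set b4 := wfac _ l'%:Z.
set T1 := rowfac l'.+1 m.+1 n; set T2 := rowfac l'.+1 m n.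
set T3 := rowfac l' m.+1 n; set T4 := rowfac l' m n.
set r1 := ratiofac l'.+1 m; set r2 := ratiofac l' m.
move=> u0 v0 b10 b20 b30 T10 T20 r10 E1 E2.
have -> : T3 / T1 * (- (v * u)^-1 * b4 / (- (v * (t * u))^-1 * b1)) =
    t * (T3 * (b4 * b3)) / ((T1 * (b1 * b2)) * b3) * b2.
  by field; rewrite b10 b20 b30 T10 u0 v0 t_neq0 oppr_eq0 oner_neq0.
rewrite E1 E2; field.
by rewrite b30 T20 r10.
Qed.

(** Here the number of columns grows, so each [rowfac] gains one factor and only [t] is left
    over. *)
Let pair_below f i a (x' := q * rowvar f i) : (a < i)%N ->
  wpair a i (f a) (f i).+1
    * ((1 - t * rowvar f a / x') / (1 - rowvar f a / x'))
  = wpair a i (f a) (f i)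
    * ((1 - rowvar f a / (t * rowvar f i)) / (1 - rowvar f a / rowvar f i)) * t.
Proof.
move=> lt_ai; rewrite /wpair lt_ai.
have [l ll'] : exists l, (i - a)%N = l.+1 by exists (i - a)%N.-1; lia.
rewrite ll' /=; set m := f i; set n := f a.
have ratio1 : rowvar f a / rowvar f i = q ^ (n%:Z - m%:Z) * t ^ (l.+1%:Z).
  rewrite rowvar_ratio; congr (_ * t ^ _); lia.
have -> : 1 - rowvar f a / rowvar f i = wfac (n%:Z - m%:Z) (l.+1%:Z).
  by rewrite ratio1.
have -> : 1 - rowvar f a / (t * rowvar f i) = wfac (n%:Z - m%:Z) (l%:Z).
  rewrite /wfac invfM mulrCA ratio1 mulrCA -[t^-1]/(t ^ (-1)) -(expfzDr _ _ t_neq0).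
  by congr (1 - _ * t ^ _); lia.
have ratio2 : rowvar f a / x' = q ^ (- (m.+1%:Z - n%:Z)) * t ^ (- - l.+1%:Z).
  rewrite invfM mulrCA ratio1 mulrA -[q^-1]/(q ^ (-1)) -(expfzDr _ _ q_neq0) opprK.
  by congr (q ^ _ * _); lia.
have -> : 1 - rowvar f a / x' = wfac (- (m.+1%:Z - n%:Z)) (- - l.+1%:Z).
  by rewrite ratio2.
have -> : 1 - t * rowvar f a / x' = wfac (- (m.+1%:Z - n%:Z)) (- - l.+2%:Z).
  rewrite /wfac -mulrA ratio2 mulrCA (mul_exprz _ t_neq0) !opprK.
  by congr (1 - _ * t ^ _); lia.
rewrite !wfacN !rowfacS.
have := @rowfac_neq0 l.+1 n m isT.
have : wfac (n%:Z - m%:Z) (l.+1%:Z) != 0 by rewrite wfac_neq0 // orbC.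
have : wfac (m.+1%:Z - n%:Z) (- l.+1%:Z) != 0 by rewrite wfac_neq0 // orbC.
have : wfac (m.+1%:Z - n%:Z) (- l.+2%:Z) != 0 by rewrite wfac_neq0 // orbC.
have -> : t ^ (- l.+2%:Z) = t ^-1 * t ^ (- l.+1%:Z).
  by rewrite -[t^-1]/(t ^ (-1)) -(expfzDr _ _ t_neq0); congr (t ^ _); lia.
have : q ^ (m.+1%:Z - n%:Z) != 0 by rewrite expfz_neq0.
have : t ^ (- l.+1%:Z) != 0 by rewrite expfz_neq0.
set u := t ^ _; set v := q ^ _.
set b1 := wfac _ (- l.+1%:Z); set b2 := wfac _ (- l.+2%:Z).
set b3 := wfac _ l.+1%:Z; set b4 := wfac _ l%:Z.
set T1 := rowfac l.+1 n m; set T2 := rowfac l n m.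
move=> u0 v0 b20 b10 b30 T10; field.
by rewrite b10 b20 b30 T10 u0 v0 t_neq0 oppr_eq0 oner_neq0.
Qed.

Let prod_ratiofac i m :
  \prod_(a < M | (i < a)%N) (ratiofac (a - i).-1 m / ratiofac (a - i) m) =
  ratiofac 0 m / ratiofac (M - i.+1) m.
Proof.
have -> : \prod_(a < M | (i < a)%N) (ratiofac (a - i).-1 m / ratiofac (a - i) m) =
    \prod_(i.+1 <= a < M) (ratiofac (a - i).-1 m / ratiofac (a - i) m).
  rewrite big_geq_mkord; apply: eq_bigl => a; exact: erefl.
suff H n : (i < n)%N -> \prod_(i.+1 <= a < n)
    (ratiofac (a - i).-1 m / ratiofac (a - i) m) =
    ratiofac 0 m / ratiofac (n - i.+1) m by exact: H (ltn_ord i).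
elim: n => // k IH; rewrite ltnS leq_eqVlt => /orP[/eqP ik|lt].
  by rewrite ik big_geq // subnn divff.
rewrite big_nat_recr //= IH // (_ : (k - i).-1 = k - i.+1)%N; last by lia.
by rewrite subSS mulrA divfK.
Qed.

Lemma weight_addbox f i :
  weight (addbox f i) * up_coef t (rowvar (addbox f i)) i =
  weight f * (t * down_coef t (rowvar f) i).
Proof.
pose m := f i; set x := rowvar f i.
have fi : addbox f i i = m.+1 by rewrite ffunE eqxx addn1.
have fa a : a != i -> addbox f i a = f a.
  by rewrite ffunE => /negbTE->; rewrite addn0.
have xi : rowvar (addbox f i) i = q * x by rewrite /rowvar fi exprS mulrA.
have xa a : a != i -> rowvar (addbox f i) a = rowvar f a.
  by move=> ai; rewrite /rowvar fa.
have x0 : x != 0 := rowvar_neq0 f i.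
pose P k := \prod_(a | a != i) (wpair i a k (f a) * wpair a i (f a) k).
pose D1 := \prod_(a | a != i) (1 - t * rowvar f a / (q * x)).
pose D2 := \prod_(a | a != i) (1 - rowvar f a / (q * x)).
pose E1 := \prod_(a | a != i) (1 - rowvar f a / (t * x)).
pose E2 := \prod_(a | a != i) (1 - rowvar f a / x).
have M_gt0 : (0 < M)%N := leq_ltn_trans (leq0n i) (ltn_ord i).
pose rM := ratiofac (M - i.+1) m.
have key : P m.+1 * (D1 / D2) = P m * (E1 / E2) *
    (t ^+ M.-1 * (ratiofac 0 m / rM)).
  rewrite -prod_ratiofac /P /D1 /D2 /E1 /E2 -!prodf_div.
  have -> : t ^+ M.-1 = \prod_(a | a != i) t by rewrite prodr_const cardC1 card_ord.
  have -> : \prod_(a < M | (i < a)%N)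
        (ratiofac (a - i).-1 m / ratiofac (a - i) m) =
      \prod_(a < M | a != i) (if (i < a)%N then
        ratiofac (a - i).-1 m / ratiofac (a - i) m else 1).
    rewrite -big_mkcondr; apply: eq_bigl => a.
    by rewrite -val_eqE /=; case: ltngtP.
  rewrite -!big_split; apply: eq_bigr => a ai /=.
  have [lt_ia|lt_ai|ia] := ssrnat.ltngtP i a; last by case/eqP: ai; apply/val_inj.
    rewrite ![wpair a i _ _]wpair_gt // !mulr1.
    exact: (@pair_above f i a lt_ia).
  rewrite ![wpair i a _ _]wpair_gt // !mul1r mulr1.
  exact: (@pair_below f i a lt_ai).
have xE : x = rowvar f i by [].
clearbody x.
have TE : rowfac 0 m.+1 m.+1 = rowfac 0 m m * ratiofac 0 m.
  by rewrite rowfacS -rowfac_addrow !subrr.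
rewrite !(weight_split _ i) fi.
have -> : \prod_(a | a != i) (wpair i a m.+1 (addbox f i a)
    * wpair a i (addbox f i a) m.+1) = P m.+1.
  by apply: eq_bigr => a ai; rewrite fa.
rewrite -/m -/(P m); set rest' := (X in _ * X * up_coef _ _ _).
set rest := (X in _ = _ * X * _).
have -> : rest' = rest.
  by apply: eq_bigr => a ai; apply: eq_bigr => b bi; rewrite !fa.
have -> : up_coef t (rowvar (addbox f i)) i =
    (q * x) * (1 - t * t ^- M / (q * x)) * (1 - t) * (D1 / D2).
  rewrite /up_coef xi (bigD1 i) //= xi -[t * (q * x) / _]mulrA divff ?mulf_neq0 //.
  rewrite mulr1 !mulrA; congr (_ * _ / _); apply: eq_bigr => a ai; rewrite xa //.
have -> : down_coef t (rowvar f) i =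
    (1 - t^-1) / (1 - t ^- M / x) * (E1 / E2).
  rewrite /down_coef (bigD1 i) //= -xE -/E1 -/E2.
  have -> : x / (t * x) = t^-1 by rewrite invfM mulrCA divff // mulr1.
  by rewrite (mulrAC _ E1) -!mulrA.
rewrite /wpair ltnn eqxx TE.
have tM : t ^ (- M%:Z) = t ^- M by rewrite -exprnN.
(* The end of the telescope accounts for the tail factors of [up_coef] (up to a monomial) and
   [down_coef]. *)
have rME : rM = (1 - q * x * t ^+ M.-1) * (1 - t ^- M / x).
  rewrite /rM /ratiofac /wfac xE rowvarE invfM !invr_expz -tM !exprnP.
  rewrite [t ^ _ * (q ^ _ * _)]mulrCA [q * (_ * _)]mulrA (mul_exprz _ q_neq0).
  rewrite -[_ * t ^ (- i%:Z) * _]mulrA -!(expfzDr _ _ t_neq0).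
  have lt_iM := ltn_ord i.
  by congr ((1 - q ^ _ * t ^ _) * (1 - q ^ _ * t ^ _)); lia.
have := ratiofac_neq0 0 m; have := ratiofac_neq0 (M - i.+1) m.
rewrite -/rM rME mulf_eq0 negb_or => /andP[n1 n2] n3.
have T0 : rowfac 0 m m != 0 by rewrite rowfac_neq0 // leqnn.
have tM0 : t ^+ M.-1 != 0 by rewrite expf_neq0.
move: key n1 n2; rewrite rME -[in t ^- M](prednK M_gt0) exprS.
set u := t ^+ M.-1 in tM0 *; set r0 := ratiofac 0 m in n3 *.
set T := rowfac 0 m m in T0 *; move=> key n1 n2.
transitivity (rest * (T^-1 / r0 * (q * x) * (1 - t * (t * u)^-1 / (q * x))
   * (1 - t) * (P m.+1 * (D1 / D2)))); first by rewrite invfM; ring.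
rewrite key; clear key; move: (E1 / E2) (P m) => e p; clearbody rest u r0 T.
have n2' : t * u * x - 1 != 0.
  apply: contraNneq n2 => /eqP; rewrite subr_eq0 => /eqP e1.
  by rewrite -invfM e1 invr1 subrr.
field.
by rewrite x0 tM0 t_neq0 n2' T0 n1 q_neq0 n3.
Qed.

End Weight.

(** * Recurrences for the weighted sums *)

Section Recurrence.

Variables (F : fieldType) (q t : F).
Hypotheses (F0 : [pchar F] =i pred0) (q_neq0 : q != 0) (t_neq0 : t != 0).
Hypothesis qt_gen : forall a b : int, q ^ a * t ^ b = 1 -> a = 0 /\ b = 0.

Let t_gen k : t ^+ k.+1 != 1.
Proof.
by apply/eqP => tk; have [] := @qt_gen 0 k.+1; rewrite ?expr0z ?mul1r.
Qed.

Variables (M K : nat).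
Implicit Types (f : {ffun 'I_M -> nat}) (i : 'I_M) (g : {ffun 'I_M -> 'I_K.+1}).

(* Up to normalization, (-1)^r e_r(q^f t^rho). *)
Definition ecoef f r : F := hcoef (vac t M) r (allfac (rowvar q t f)).
Definition ebut f i r : F := hcoef (vac t M) r (facbut (rowvar q t f) i).

Lemma ecoef0 f : ecoef f 0 = 1.
Proof. by rewrite /ecoef hcoef_allfac. Qed.

Lemma ebutS f i r : ebut f i r.+1 = ecoef f r.+1 + rowvar q t f i * ebut f i r.
Proof. exact: hcoef_facbut. Qed.

Lemma ebut0 f i : ebut f i 0 = ecoef f 0.
Proof. exact: hcoef_facbut0. Qed.

Lemma ebut_addbox f i r : ebut (addbox f i) i r = ebut f i r.
Proof.
congr (hcoef _ _ _); apply: eq_bigr => j /negbTE ji.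
by rewrite /rowvar ffunE ji addn0.
Qed.

Lemma rowvar_addbox f i : rowvar q t (addbox f i) i = q * rowvar q t f i.
Proof. by rewrite /rowvar ffunE eqxx addn1 exprS mulrA. Qed.

Lemma ecoef_up f r : (t ^+ r.+1 - 1) * ecoef f r.+1 =
  - t * ecoef f r + \sum_i up_coef t (rowvar q t f) i * ebut f i r.
Proof.
apply: hcoef_up => //; first exact: rowvar_inj.
by move=> i; apply: rowvar_neq0.
Qed.

(** A partition with fewer boxes than M has an empty last row, as [hcoef_down] requires; other
    tuples have weight 0. *)
Lemma ecoef_down f r : (\sum_i f i < M)%N ->
  weight q t f * (\sum_i down_coef t (rowvar q t f) i * ebut f i r) =
  weight q t f * (t ^- r * ecoef f r).
Proof.
move=> lt_fM; have [->|wf] := eqVneq (weight q t f) 0; first by rewrite !mul0r.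
have lt_M : (M.-1 < M)%N by lia.
pose i0 := Ordinal lt_M.
have fi0 : f i0 = 0%N.
  apply/eqP; rewrite -leqn0 leqNgt; apply/negP => f_gt0.
  have : (\sum_(i < M) 1 <= \sum_i f i)%N.
    apply: leq_sum => i _; apply: leq_trans f_gt0 _.
    by apply: weight_noninc wf _ => //=; have := ltn_ord i; lia.
  by rewrite sum1_card card_ord leqNgt lt_fM.
congr (_ * _); rewrite /ecoef (@hcoef_down _ _ F0 t_neq0 t_gen _ _ _ _ r i0).
- by rewrite mulKf ?expf_neq0.
- exact: rowvar_inj.
- by move=> i; apply: rowvar_neq0.
- rewrite /rowvar fi0 mul1r /= -[in t ^- M](prednK (leq_ltn_trans _ lt_M)) // exprS.
  by field; rewrite t_neq0 expf_neq0.
- by move=> i; apply: vac_rowvar_neq0.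
Qed.

Definition nats g : {ffun 'I_M -> nat} := [ffun i => val (g i)].

Definition weighted_sum (Phi : {ffun 'I_M -> nat} -> F) n : F :=
  \sum_(g | (\sum_i nats g i == n)%N) weight q t (nats g) * Phi (nats g).

Lemma weighted_sum_box (c : F) (Phi Psi : {ffun 'I_M -> nat} -> 'I_M -> F) n :
  (n < K)%N ->
  (forall f i, Phi (addbox f i) i = c * Psi f i) ->
  weighted_sum (fun f => \sum_i up_coef t (rowvar q t f) i * Phi f i) n.+1 =
  t * c * weighted_sum (fun f => \sum_i down_coef t (rowvar q t f) i * Psi f i) n.
Proof.
move=> lt_nK PhiPsi.
have split_sum (H : {ffun 'I_M -> nat} -> 'I_M -> F) n' :
    weighted_sum (fun f => \sum_i H f i) n' =
    \sum_i \sum_(g | (\sum_i nats g i == n')%N) weight q t (nats g) * H (nats g) i.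
  by rewrite exchange_big; apply: eq_bigr => g _; rewrite mulr_sumr.
rewrite !split_sum mulr_sumr; apply: eq_bigr => i _.
rewrite (bigID (fun g => nats g i == 0)%N) /= big1 ?add0r => [|g]; last first.
  by case/andP=> _ /eqP gi; rewrite mulrA up_coef_eq0 ?mul0r.
(* The cyclic successor makes [bump] a bijection of bounded tuples. *)
pose bump g : {ffun 'I_M -> 'I_K.+1} := [ffun j => if j == i then ordS (g j) else g j].
pose unbump g : {ffun 'I_M -> 'I_K.+1} :=
  [ffun j => if j == i then ord_pred (g j) else g j].
have bumpK : cancel bump unbump.
  by move=> g; apply/ffunP => j; rewrite !ffunE; case: eqP => // _; rewrite ordSK.
have unbumpK : cancel unbump bump.
  by move=> g; apply/ffunP => j; rewrite !ffunE; case: eqP => // _; rewrite ord_predK.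
have natsb g : (g i < K)%N -> nats (bump g) = addbox (nats g) i.
  move=> lt_gK; apply/ffunP => j; rewrite !ffunE; case: eqP => [->|_] /=.
    by rewrite modn_small // addn1.
  by rewrite addn0.
have sum_addbox f : (\sum_j addbox f i j = (\sum_j f j).+1)%N.
  rewrite (eq_bigr (fun j => f j + (j == i))%N) => [|j _]; last by rewrite ffunE.
  rewrite big_split /= -addn1; congr addn.
  by rewrite (bigD1 i) //= eqxx big1 // => j /negbTE->.
rewrite (reindex_onto bump unbump) /=; last by move=> g _; apply: unbumpK.
rewrite mulr_sumr (eq_bigl (fun g => (\sum_i nats g i == n)%N)) => [|g].
  apply: eq_bigr => g /eqP sg.
  have lt_gK : (g i < K)%N.
    apply: leq_ltn_trans lt_nK; rewrite -sg (bigD1 i) //= {1}/nats ffunE.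
    exact: leq_addr.
  rewrite natsb // mulrA weight_addbox // PhiPsi.
  by ring.
rewrite bumpK eqxx andbT.
have [lt_gK|le_Kg] := ltnP (g i) K.
  by rewrite natsb // sum_addbox eqSS [addbox _ _ _]ffunE eqxx addn1 andbT.
(* Wrap-around: the bumped row is 0, which one condition excludes, while n < K excludes [g] from the
   other. *)
have gK : g i = K :> nat by apply/eqP; rewrite eqn_leq le_Kg -ltnS ltn_ord.
rewrite [nats (bump g) i]ffunE [bump g i]ffunE eqxx /= gK modnn eqxx andbF.
apply/esym/negbTE; apply: contraL lt_nK => /eqP <-.
by rewrite -leqNgt (bigD1 i) //= [nats g i]ffunE /= gK leq_addr.
Qed.

Lemma weighted_sum_box0 (Phi : {ffun 'I_M -> nat} -> 'I_M -> F) :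
  weighted_sum (fun f => \sum_i up_coef t (rowvar q t f) i * Phi f i) 0 = 0.
Proof.
apply: big1 => g; rewrite sum_nat_eq0 => /forallP g0.
rewrite mulr_sumr big1 // => i _; rewrite mulrA up_coef_eq0 ?mul0r //.
exact/eqP/(implyP (g0 i)).
Qed.

Lemma weighted_sumD (Phi Psi : {ffun 'I_M -> nat} -> F) n :
  weighted_sum (fun f => Phi f + Psi f) n = weighted_sum Phi n + weighted_sum Psi n.
Proof. by rewrite -big_split; apply: eq_bigr => g _; rewrite mulrDr. Qed.

Lemma weighted_sumZ (c : F) (Phi : {ffun 'I_M -> nat} -> F) n :
  weighted_sum (fun f => c * Phi f) n = c * weighted_sum Phi n.
Proof. by rewrite mulr_sumr; apply: eq_bigr => g _; rewrite mulrCA. Qed.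

Lemma eq_weighted_sum (Phi Psi : {ffun 'I_M -> nat} -> F) n :
  (forall f, (\sum_i f i)%N = n ->
     weight q t f * Phi f = weight q t f * Psi f) ->
  weighted_sum Phi n = weighted_sum Psi n.
Proof. by move=> PhiPsi; apply: eq_bigr => g /eqP; apply: PhiPsi. Qed.

Definition emoment r s n := weighted_sum (fun f => ecoef f r * ecoef f s) n.

Lemma emoment_col0 r :
  (t ^+ r.+1 - 1) * emoment r.+1 0 0 = - t * emoment r 0 0.
Proof.
rewrite /emoment -!weighted_sumZ.
rewrite -[RHS]addr0 -(weighted_sum_box0 (fun f i => ebut f i r)) -weighted_sumD.
by apply: eq_weighted_sum => f _; rewrite !ecoef0 !mulr1 ecoef_up.
Qed.

Lemma emoment_colS r n : (n < M)%N -> (n < K)%N ->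
  (t ^+ r.+1 - 1) * emoment r.+1 0 n.+1 =
  - t * (emoment r 0 n.+1 - t ^- r * emoment r 0 n).
Proof.
move=> lt_nM lt_nK.
have -> : - t * (emoment r 0 n.+1 - t ^- r * emoment r 0 n) =
    - t * emoment r 0 n.+1 + t * (t ^- r * emoment r 0 n) by ring.
rewrite /emoment -!weighted_sumZ.
transitivity (weighted_sum (fun f => - t * (ecoef f r * ecoef f 0)
    + \sum_i up_coef t (rowvar q t f) i * ebut f i r) n.+1).
  by apply: eq_weighted_sum => f _; rewrite !ecoef0 !mulr1 ecoef_up.
rewrite weighted_sumD; congr (_ + _).
rewrite (@weighted_sum_box 1 _ (fun f i => ebut f i r)) // => [|f i]; last by rewrite ebut_addbox mul1r.
rewrite mulr1 -weighted_sumZ; apply: eq_weighted_sum => f fn.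
by rewrite mulrCA ecoef_down ?fn // ecoef0 mulr1; ring.
Qed.

Let comm_coef f i r s : F := ebut f i r * ecoef f s - ecoef f r * ebut f i s.

(** By E = (1 - x_i z) E_i, the terms free of x_i cancel and [comm_coef] is x_i times an expression
    in [ebut] alone. *)
Let comm_coef_addbox f i r s :
  comm_coef (addbox f i) i r s = q * comm_coef f i r s.
Proof.
have E f' k : ecoef f' k = ebut f' i k -
    (if k is k'.+1 then rowvar q t f' i * ebut f' i k' else 0).
  by case: k => [|k]; rewrite ?ebutS ?ebut0 ?subr0 // addrK.
rewrite /comm_coef !E !ebut_addbox rowvar_addbox.
by case: r s => [|r] [|s]; rewrite ?ebut_addbox; ring.
Qed.

Let ecoef_comm f r s :
  (t ^+ r.+1 - 1) * (ecoef f r.+1 * ecoef f s)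
  - (t ^+ s.+1 - 1) * (ecoef f r * ecoef f s.+1) =
  \sum_i up_coef t (rowvar q t f) i * comm_coef f i r s.
Proof.
rewrite /comm_coef; under [RHS]eq_bigr => i _ do
  rewrite mulrBr mulrA [X in _ - X]mulrCA.
rewrite sumrB -mulr_suml -mulr_sumr mulrA ecoef_up [X in _ - X]mulrCA ecoef_up.
by ring.
Qed.

Lemma emoment_comm0 r s :
  (t ^+ r.+1 - 1) * emoment r.+1 s 0 - (t ^+ s.+1 - 1) * emoment r s.+1 0 = 0.
Proof.
rewrite -[RHS](weighted_sum_box0 (fun f i => comm_coef f i r s)).
rewrite /emoment -mulNr -!weighted_sumZ -weighted_sumD.
by apply: eq_weighted_sum => f _; rewrite mulNr ecoef_comm.
Qed.

Lemma emoment_commS r s n : (n < M)%N -> (n < K)%N ->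
  (t ^+ r.+1 - 1) * emoment r.+1 s n.+1 - (t ^+ s.+1 - 1) * emoment r s.+1 n.+1
  = t * q * (t ^- r - t ^- s) * emoment r s n.
Proof.
move=> lt_nM lt_nK; rewrite /emoment -mulNr -!weighted_sumZ -weighted_sumD.
transitivity (weighted_sum (fun f =>
    \sum_i up_coef t (rowvar q t f) i * comm_coef f i r s) n.+1).
  by apply: eq_weighted_sum => f _; rewrite mulNr ecoef_comm.
rewrite (@weighted_sum_box q _ (fun f i => comm_coef f i r s)) //.
rewrite -weighted_sumZ; apply: eq_weighted_sum => f fn.
have -> : \sum_i down_coef t (rowvar q t f) i * comm_coef f i r s =
    (\sum_i down_coef t (rowvar q t f) i * ebut f i r) * ecoef f s
    - ecoef f r * (\sum_i down_coef t (rowvar q t f) i * ebut f i s).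
  rewrite mulr_suml mulr_sumr -sumrB; apply: eq_bigr => i _.
  by rewrite /comm_coef; ring.
have Dr := @ecoef_down f r; have Ds := @ecoef_down f s.
rewrite fn in Dr Ds; have {}Dr := Dr lt_nM; have {}Ds := Ds lt_nM.
move: Dr Ds; set A := \sum_i _ * ebut f i r; set B := \sum_i _ * ebut f i s.
set w := weight q t f => Dr Ds.
transitivity (t * q * ((w * A) * ecoef f s - ecoef f r * (w * B))).
  by ring.
by rewrite Dr Ds; ring.
Qed.

End Recurrence.

(** * From partitions to bounded tuples of rows *)

Section Partitions.

Implicit Types s eta : seq nat.

Lemma ltn_conjpart eta i j : sorted geq eta -> (0 < j)%N ->
  (i < conjpart eta j)%N = (j <= nth 0%N eta i)%N.
Proof.
rewrite /conjpart => + j_gt0; elim: eta i => [|x s IH] i.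
  by rewrite nth_nil leqn0 eqn0Ngt j_gt0.
rewrite /= path_sortedE; last by move=> ? ? ? /= le1 le2; apply: leq_trans le2 le1.
case/andP=> /allP le_x /IH {}IH.
have [le_jx|lt_xj] := leqP j x; first by case: i => [|i] //=; rewrite add1n ltnS.
have s0 i' : (j <= nth 0%N s i')%N = false.
  apply/negbTE; rewrite -ltnNge; have [lt_is|le_si] := ltnP i' (size s).
    exact: leq_ltn_trans (le_x _ (mem_nth _ lt_is)) lt_xj.
  by rewrite nth_default.
rewrite add0n (_ : count _ _ = 0)%N ?ltn0.
  by case: i => [|i] /=; rewrite ?s0 // leqNgt lt_xj.
by apply/eqP; rewrite -leqn0 leqNgt IH s0.
Qed.

Lemma plength_le_sumn eta : (plength eta <= sumn eta)%N.
Proof. by rewrite /plength /conjpart; elim: eta => //= x s IH; case: x => //= x; lia. Qed.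

Lemma nth_gt_sumn eta i : sorted geq eta -> (sumn eta <= i)%N -> nth 0%N eta i = 0%N.
Proof.
move=> srt le_i; apply/eqP; rewrite -leqn0 leqNgt -ltn_conjpart // -leqNgt.
exact: leq_trans (plength_le_sumn _) le_i.
Qed.

Lemma leq_nth_sumn eta i : (nth 0%N eta i <= sumn eta)%N.
Proof.
by elim: eta i => [|x s IH] [|i] //=; rewrite ?leq_addr // (leq_trans (IH i)) ?leq_addl.
Qed.

Lemma sum_nth eta n : (size eta <= n)%N -> (\sum_(i < n) nth 0%N eta i)%N = sumn eta.
Proof.
move=> le_n; rewrite sumnE (big_nth 0%N) -(big_mkord xpredT) /=.
rewrite (big_cat_nat (n := size eta)) //= [X in (_ + X)%N]big_nat_cond.
by rewrite [X in (_ + X)%N]big1 ?addn0 // => i /andP[/andP[le_i _] _]; rewrite nth_default.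
Qed.

Lemma sum_nth_sorted eta n : sorted geq eta -> (sumn eta <= n)%N ->
  (\sum_(i < n) nth 0%N eta i)%N = sumn eta.
Proof.
move=> srt le_n; have [le|lt] := leqP (size eta) n; first exact: sum_nth.
rewrite -(@sum_nth eta (size eta)) // -!(big_mkord xpredT (nth 0%N eta)).
rewrite [RHS](big_cat_nat (leq0n n) (ltnW lt)) /=.
rewrite [X in (_ + X)%N]big_nat_cond.
rewrite [X in (_ + X)%N]big1 ?addn0 // => i /andP[/andP[le_i _] _].
by rewrite nth_gt_sumn // (leq_trans le_n).
Qed.

End Partitions.

Section PartitionSums.

Variables (F : fieldType) (M K n : nat).
Hypotheses (le_nM : (n <= M)%N) (le_nK : (n <= K)%N).
Implicit Types g : {ffun 'I_M -> 'I_K.+1}.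

Definition rows M (eta : seq nat) : {ffun 'I_M -> nat} := [ffun i : 'I_M => nth 0%N eta i].

Let seq_of g : seq nat := [seq nats g i | i <- enum 'I_M].

Let nth_seq_of g (i : 'I_M) : nth 0%N (seq_of g) i = g i.
Proof. by rewrite (nth_map i) ?size_enum_ord // nth_ord_enum ffunE. Qed.

Let size_seq_of g : size (seq_of g) = M.
Proof. by rewrite size_map size_enum_ord. Qed.

Let sumn_seq_of g : sumn (seq_of g) = (\sum_i nats g i)%N.
Proof.
rewrite -(@sum_nth _ M) ?size_seq_of //; apply: eq_bigr => i _.
by rewrite nth_seq_of ffunE.
Qed.

Let to_fun (eta : n.-tuple 'I_n.+1) : {ffun 'I_M -> 'I_K.+1} :=
  [ffun i : 'I_M => inord (nth 0%N (parts_of eta) i)].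

Let to_tuple g : n.-tuple 'I_n.+1 :=
  [tuple inord (nth 0%N (seq_of g) i) | i < n].

Let size_parts_of (eta : n.-tuple 'I_n.+1) : size (parts_of eta) = n.
Proof. by rewrite size_map size_tuple. Qed.

Let nth_to_tuple g i : sorted geq (seq_of g) -> sumn (seq_of g) = n ->
  nth 0%N (parts_of (to_tuple g)) i = nth 0%N (seq_of g) i.
Proof.
move=> srt sum_n; have [lt_in|le_ni] := ltnP i n; last first.
  rewrite nth_default ?size_parts_of //.
  by rewrite nth_gt_sumn // sum_n.
rewrite /parts_of (nth_map ord0) ?size_tuple //.
rewrite (_ : nth _ _ _ = tnth (to_tuple g) (Ordinal lt_in)).
  by rewrite tnth_mktuple /= inordK // ltnS -[leqRHS]sum_n leq_nth_sumn.
by rewrite (tnth_nth ord0).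
Qed.

(** Partitions of n have at most n nonzero parts, each at most n, so changing the numbers of rows
    and the bound only moves zeros; the condition on [G] discards tuples that are not partitions. *)
Lemma partition_sum (H : seq nat -> F) (G : {ffun 'I_M -> nat} -> F) :
  (forall eta, sorted geq eta -> sumn eta = n -> H eta = G (rows M eta)) ->
  (forall f, G f != 0 -> forall i j : 'I_M, (i <= j)%N -> (f j <= f i)%N) ->
  \sum_(eta : n.-tuple 'I_n.+1 | is_partition_of n (parts_of eta)) H (parts_of eta)
  = \sum_(g : {ffun 'I_M -> 'I_K.+1} | (\sum_i nats g i == n)%N) G (nats g).
Proof.
move=> HG G0.
pose P g := sorted geq (seq_of g) && (sumn (seq_of g) == n).
have to_funK g : P g -> to_fun (to_tuple g) = g.
  case/andP=> srt /eqP sum_n; apply/ffunP => i; rewrite ffunE; apply/val_inj.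
  rewrite /= nth_to_tuple // nth_seq_of inordK //.
have part_to_tuple g : P g -> is_partition_of n (parts_of (to_tuple g)).
  move=> Pg; have [srt /eqP sum_n] := andP Pg.
  have srt' : sorted geq (parts_of (to_tuple g)).
    apply/(sortedP 0%N) => i lt_i; rewrite !nth_to_tuple //.
    move/(sortedP 0%N): srt => srt; have [lt|le] := ltnP i.+1 (size (seq_of g)).
      exact: srt.
    by rewrite /= [X in (X <= _)%N]nth_default.
  rewrite /is_partition_of srt' /= -(@sum_nth _ M) ?size_parts_of //.
  rewrite -{2}sum_n sumn_seq_of; apply/eqP; apply: eq_bigr => i _.
  by rewrite nth_to_tuple // nth_seq_of ffunE.
have val_to_fun eta (i : 'I_M) : is_partition_of n (parts_of eta) ->
    to_fun eta i = nth 0%N (parts_of eta) i :> nat.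
  case/andP=> _ /eqP sum_n; rewrite ffunE inordK // ltnS.
  by rewrite (leq_trans (leq_nth_sumn _ _)) // sum_n.
have nats_to_fun eta : is_partition_of n (parts_of eta) ->
    nats (to_fun eta) = rows M (parts_of eta).
  move=> Peta; apply/ffunP => i; rewrite [LHS]ffunE [RHS]ffunE; exact: val_to_fun.
have P_to_fun eta : is_partition_of n (parts_of eta) -> P (to_fun eta).
  move=> Peta; have [srt /eqP sum_n] := andP Peta.
  rewrite /P sumn_seq_of nats_to_fun //.
  rewrite (eq_bigr (fun i : 'I_M => nth 0%N (parts_of eta) i)); last first.
    by move=> i _; rewrite ffunE.
  rewrite sum_nth_sorted ?sum_n // eqxx andbT.
  apply/(sortedP 0%N) => i; rewrite size_seq_of => lt_i.
  rewrite (nth_seq_of _ (Ordinal lt_i)) (nth_seq_of _ (Ordinal (ltnW lt_i))).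
  rewrite /= !val_to_fun //=.
  have [lt|le] := ltnP i.+1 (size (parts_of eta)).
    by move/(sortedP 0%N): srt; apply.
  by rewrite [X in (X <= _)%N]nth_default.
transitivity (\sum_(g | P g) G (nats g)); last first.
  symmetry; rewrite (bigID P) /= [X in _ + X]big1 ?addr0 => [|g]; last first.
    case/andP=> sum_n; apply: contraNeq => Gg; rewrite /P sumn_seq_of sum_n andbT.
    apply/(sortedP 0%N) => i; rewrite size_seq_of => lt_i.
    rewrite (nth_seq_of _ (Ordinal lt_i)) (nth_seq_of _ (Ordinal (ltnW lt_i))).
    have := G0 _ Gg (Ordinal (ltnW lt_i)) (Ordinal lt_i).
    by rewrite !ffunE /=; apply.
  by apply: eq_bigl => g; rewrite /P sumn_seq_of andbC -andbA andbb.
rewrite (reindex_onto to_fun to_tuple) => [|g]; last exact: to_funK.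
rewrite [RHS](eq_bigl (fun eta => is_partition_of n (parts_of eta))) => [|eta].
  apply: eq_bigr => eta Peta; rewrite nats_to_fun //.
  by have [srt /eqP sum_n] := andP Peta; apply: HG.
apply/andP/idP => [[Pg /eqP <-]|Peta]; first exact: part_to_tuple.
have Pg := P_to_fun _ Peta; split=> //; apply/eqP/val_inj/(inj_map val_inj).
apply: (@eq_from_nth _ 0%N) => [|i _]; first by rewrite -!/(parts_of _) !size_parts_of.
have [srt /eqP sum_n] := andP Pg.
rewrite -/(parts_of _) -/(parts_of eta) nth_to_tuple //.
have [lt_iM|le_Mi] := ltnP i M.
  by rewrite (nth_seq_of _ (Ordinal lt_iM)) val_to_fun.
by rewrite !nth_default ?size_seq_of ?size_parts_of // (leq_trans le_nM).
Qed.

End PartitionSums.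

(** * The box weight and the specialized power sums in terms of rows *)

Section Specialization.

Variables (F : fieldType) (q h : F).
Hypotheses (F0 : [pchar F] =i pred0) (q_neq0 : q != 0) (h_neq0 : h != 0).
Let t : F := h ^+ 2.
Hypothesis qt_gen : forall a b : int, q ^ a * t ^ b = 1 -> a = 0 /\ b = 0.

Let t_neq0 : t != 0. Proof. exact: expf_neq0. Qed.

Definition power_spec (eta : seq nat) (n : nat) : F :=
  \sum_(1 <= i < (plength eta).+1)
     (q ^+ (n * part eta i) - 1) * h ^ (n%:Z * (1 - 2 * i%:Z))
  + (h ^+ n - h ^- n)^-1.

Definition box_weight (eta : seq nat) : F :=
  \prod_(1 <= i < (plength eta).+1) \prod_(1 <= j < (part eta i).+1)
    ((1 - q ^ ((part eta i)%:Z - j%:Z + 1) * t ^ ((conjpart eta j)%:Z - i%:Z)) *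
     (1 - q ^ (- (part eta i)%:Z + j%:Z)
            * t ^ (- (conjpart eta j)%:Z + i%:Z - 1)))^-1.

Variables (M : nat) (eta : seq nat).
Hypotheses (srt : sorted geq eta) (le_M : (sumn eta <= M)%N).

Let nth_geM i : (M <= i)%N -> nth 0%N eta i = 0%N.
Proof. by move=> le_Mi; rewrite nth_gt_sumn // (leq_trans le_M). Qed.

Let plength_leM : (plength eta <= M)%N.
Proof. exact: leq_trans (plength_le_sumn _) le_M. Qed.

Let nth_ge_plength i : (plength eta <= i)%N -> nth 0%N eta i = 0%N.
Proof.
by move=> le; apply/eqP; rewrite -leqn0 leqNgt -ltn_conjpart // -leqNgt.
Qed.

(* The two factors of the box in row i + 1 and column j + 1.                  *)
Let boxfac (i j : nat) : F :=
  wfac q t ((nth 0%N eta i)%:Z - j%:Z) ((conjpart eta j.+1)%:Z - i.+1%:Z) *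
  wfac q t (j.+1%:Z - (nth 0%N eta i)%:Z) (i%:Z - (conjpart eta j.+1)%:Z).

(** The last factor holds the columns not yet treated, those reaching below row n; it becomes
    trivial once that row is empty. *)
Let row_prod i n : (i <= n)%N ->
  \prod_(0 <= j < nth 0%N eta i) boxfac i j =
  rowfac q t 0 (nth 0%N eta i) (nth 0%N eta i)
  * \prod_(i.+1 <= k < n.+1)
      (rowfac q t (k - i) (nth 0%N eta i) (nth 0%N eta k)
       / rowfac q t (k - i).-1 (nth 0%N eta i) (nth 0%N eta k))
  * (\prod_(0 <= j < nth 0%N eta n) boxfac i j
     / rowfac q t (n - i) (nth 0%N eta i) (nth 0%N eta n)).
Proof.
set m := nth 0%N eta i; set G := boxfac i.
have noninc k : (nth 0%N eta k.+1 <= nth 0%N eta k)%N.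
  have [lt|le] := ltnP k.+1 (size eta); last by rewrite nth_default.
  by move/(sortedP 0%N): srt; apply.
have le_m k : (i <= k)%N -> (nth 0%N eta k <= m)%N.
  elim: k => [|k IH]; first by rewrite leqn0 => /eqP i0; rewrite /m i0.
  rewrite leq_eqVlt => /orP[/eqP<-//|]; rewrite ltnS => /IH.
  exact: leq_trans (noninc k).
have nz l k : (i <= k)%N -> rowfac q t l m (nth 0%N eta k) != 0.
  by move=> le_ik; rewrite rowfac_neq0 // le_m ?orbT.
have base : \prod_(0 <= j < m) G j =
    rowfac q t 0 m m * (\prod_(0 <= j < m) G j / rowfac q t 0 m m).
  by rewrite mulrCA mulfV ?mulr1 // nz.
move=> /subnK <-; elim: (n - i)%N => {n} [|d IH].
  by rewrite add0n [X in _ * X * _]big_geq // mulr1 subnn -/m.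
rewrite {}IH addSn; set n := (d + i)%N; have le_in : (i <= n)%N by apply: leq_addl.
rewrite [in RHS]big_nat_recr ?ltnS //= -!mulrA; congr (_ * (_ * _)).
rewrite (big_cat_nat (leq0n _) (noninc n)) /=.
have -> : \prod_(nth 0%N eta n.+1 <= j < nth 0%N eta n) G j =
    rowfac q t (n - i) m (nth 0%N eta n)
    / rowfac q t (n - i) m (nth 0%N eta n.+1).
  apply: (canRL (mulfK (nz _ _ (leqW le_in)))).
  pose H j := wfac q t (m%:Z - j%:Z) (n - i)%N%:Z
    * wfac q t (j.+1%:Z - m%:Z) (- (n - i).+1%:Z).
  rewrite /rowfac -!(big_mkord xpredT H).
  rewrite [RHS](big_cat_nat (leq0n _) (noninc n)) /= mulrC; congr (_ * _).
  rewrite big_nat_cond [RHS]big_nat_cond; apply: eq_bigr => j.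
  case/andP=> /andP[le_j lt_j] _.
  (* Columns between the lengths of two consecutive rows end at the upper one, hence have leg n -
     i. *)
  have cj : conjpart eta j.+1 = n.+1.
    apply/eqP; rewrite eqn_leq [X in _ && X]ltn_conjpart // lt_j andbT.
    by rewrite leqNgt ltn_conjpart // -leqNgt.
  rewrite /G /H /boxfac cj; congr (wfac _ _ _ _ * wfac _ _ _ _); lia.
have -> : (n.+1 - i).-1 = (n - i)%N by lia.
have := nz (n - i)%N n le_in; have := nz (n - i)%N _ (leqW le_in).
have := nz (n.+1 - i)%N _ (leqW le_in).
set a := rowfac _ _ _ _ _; set b := rowfac _ _ _ _ _; set c := rowfac _ _ _ _ _.
move=> a0 b0 c0; field.
by rewrite a0 b0 c0.
Qed.

Lemma box_weightE : box_weight eta = weight q t (rows M eta).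
Proof.
rewrite /box_weight big_add1 /=.
pose R i := \prod_(0 <= j < nth 0%N eta i) boxfac i j.
transitivity (\prod_(0 <= i < plength eta) (R i)^-1).
  apply: eq_bigr => i _; rewrite /R -prodfV big_add1 /part /=.
  apply: eq_bigr => j _; rewrite /boxfac /wfac; congr (_^-1).
  by congr ((1 - q ^ _ * t ^ _) * (1 - q ^ _ * t ^ _)); lia.
transitivity (\prod_(0 <= i < M) (R i)^-1).
  rewrite [RHS](big_cat_nat (leq0n _) plength_leM) /= [X in _ * X]big_nat_cond.
  rewrite [X in _ * X]big1 ?mulr1 // => i /andP[/andP[le_i _] _].
  by rewrite /R nth_ge_plength // big_geq // invr1.
rewrite big_mkord /weight; apply: eq_bigr => i _.
rewrite /R (@row_prod i M) ?(ltnW (ltn_ord i)) // big_nat_recr ?ltn_ord //=.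
rewrite (nth_geM (leqnn M)) !rowfac0 [X in _ * (X / 1)]big_geq // !divr1 !mulr1.
rewrite invfM (bigD1 i) //= {1}/wpair ltnn eqxx !ffunE; congr (_ * _).
rewrite -prodfV big_geq_mkord big_mkcond [RHS]big_mkcond /=; apply: eq_bigr => k _.
rewrite /wpair !ffunE -val_eqE /= eq_sym.
by case: ssrnat.ltngtP => //=; rewrite ?invfM ?invrK // mulrC.
Qed.

(** The closed term is the geometric series over all empty rows; the -1 in each summand removes its
    first M terms, leaving [vac]. *)
Lemma power_specE k : - power_spec eta k.+1 = h^-1 ^+ k.+1 *
  (vac t M k.+1 - \sum_i rowvar q t (rows M eta) i ^+ k.+1).
Proof.
set n := k.+1; pose y := t ^- n.
have yE i : (t ^- i) ^+ n = y ^+ i by rewrite /y -!exprVn exprAC.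
pose G i := (q ^+ (n * nth 0%N eta i) - 1) * h^-1 ^+ n * y ^+ i.
rewrite /power_spec big_add1 /=.
have -> : \sum_(0 <= i < plength eta) (q ^+ (n * part eta i.+1) - 1)
     * h ^ (n%:Z * (1 - 2 * i.+1%:Z)) = \sum_(i < M) G i.
  rewrite -(big_mkord xpredT G) [RHS](big_cat_nat (leq0n _) plength_leM) /=.
  rewrite [X in _ = _ + X]big_nat_cond [X in _ = _ + X]big1 ?addr0; last first.
    move=> i /andP[/andP[le_i _] _].
    by rewrite /G nth_ge_plength // muln0 subrr !mul0r.
  apply: eq_bigr => i _; rewrite /G -mulrA -yE /t -exprM -!exprVn -!exprM -exprD.
  have -> : n%:Z * (1 - 2 * i.+1%:Z) = - (n + 2 * (i * n))%N%:Z :> int by nia.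
  by rewrite -exprnN -exprVn; congr (_ * _ ^+ _); nia.
have -> : \sum_(i < M) G i = h^-1 ^+ n *
    (\sum_i rowvar q t (rows M eta) i ^+ n - \sum_(i < M) y ^+ i).
  rewrite -sumrB mulr_sumr; apply: eq_bigr => i _.
  by rewrite /G /rowvar ffunE exprMn yE -exprM [(n * _)%N]mulnC; ring.
have y1 : 1 - y != 0.
  rewrite subr_eq0; apply/eqP => /esym yn1.
  have [] := @qt_gen 0 (- n%:Z); last by [].
  by rewrite expr0z mul1r -exprnN.
have geom : \sum_(i < M) y ^+ i = (1 - y ^+ M) / (1 - y).
  by apply: (canRL (mulfK y1)); rewrite mulrC -opprB mulNr -subrX1 opprB.
rewrite geom /vac yE -/y exprVn.
have yH : y = (h ^+ n * h ^+ n)^-1 by rewrite /y /t -exprM mulSn mul1n exprD.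
have H0 : h ^+ n != 0 by rewrite expf_neq0.
move: y1 H0; rewrite -/y yH; set H := h ^+ n; set Y := (_ ^+ M).
set S := \sum_i _ => y1 H0; field.
rewrite H0; apply: contraNneq y1 => /eqP; rewrite subr_eq0 => /eqP->.
by rewrite invr1 subrr.
Qed.

Lemma schur_power_spec r : schur (power_spec eta) (onecol r) =
  (-1) ^+ r * h ^- r * ecoef q t (rows M eta) r.
Proof.
rewrite schur_onecol // -mulrA; congr (_ * _).
rewrite (@eq_hsym _ F0 _ (fun k => h^-1 ^+ k * (vac t M k
  - \sum_i rowvar q t (rows M eta) i ^+ k)) power_specE).
rewrite (hsym_scale F0 h^-1 (fun k => _ - _)) exprVn.
by rewrite /ecoef hcoef_allfac.
Qed.

End Specialization.

(** * The recurrences for the coefficients of the series in Q *)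

Section Series.

Variables (F : fieldType) (q h : F).
Hypotheses (F0 : [pchar F] =i pred0) (q_neq0 : q != 0) (h_neq0 : h != 0).
Let t : F := h ^+ 2.
Hypothesis qt_gen : forall a b : int, q ^ a * t ^ b = 1 -> a = 0 /\ b = 0.

Let t_neq0 : t != 0. Proof. exact: expf_neq0. Qed.

Definition partition_series (r s n : nat) : F :=
  \sum_(eta : n.-tuple 'I_n.+1 | is_partition_of n (parts_of eta))
     schur (power_spec q h (parts_of eta)) (onecol r)
     * schur (power_spec q h (parts_of eta)) (onecol s)
     * box_weight q h (parts_of eta).

Lemma partition_seriesE M K r s n : (n <= M)%N -> (n <= K)%N ->
  partition_series r s n =
  (-1) ^+ (r + s) * h ^- (r + s) * emoment q t M K r s n.
Proof.
move=> le_nM le_nK; rewrite /emoment -weighted_sumZ.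
apply: (partition_sum (H := fun eta => schur (power_spec q h eta) (onecol r)
  * schur (power_spec q h eta) (onecol s) * box_weight q h eta)
  (G := fun f => weight q t f * ((-1) ^+ (r + s) * h ^- (r + s)
         * (ecoef q t f r * ecoef q t f s))) le_nM le_nK) => [eta srt sum_n|f].
  have le_M : (sumn eta <= M)%N by rewrite sum_n.
  rewrite !(schur_power_spec F0 _ _ _ srt le_M) // (box_weightE _ _ _ srt le_M) //.
  by rewrite -!exprVn !exprD; ring.
by rewrite mulf_eq0 negb_or => /andP[wf _] i j; apply: (weight_noninc q_neq0 t_neq0) wf.
Qed.

Lemma partition_series_col0 r :
  (t ^+ r.+1 - 1) * partition_series r.+1 0 0 = h * partition_series r 0 0.
Proof.
rewrite !(@partition_seriesE 0 0) //.
have E := emoment_col0 F0 q_neq0 t_neq0 qt_gen 0 0 r.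
rewrite mulrCA E !addn0; set a := emoment _ _ _ _ _ _ _.
rewrite [h ^+ r.+1]exprS [_ ^+ r.+1]exprS /t; set v := h ^+ r.
have v0 : v != 0 by rewrite expf_neq0.
by field; rewrite v0 h_neq0.
Qed.

Lemma partition_series_colS r n :
  (t ^+ r.+1 - 1) * partition_series r.+1 0 n.+1 =
  h * (partition_series r 0 n.+1 - t ^- r * partition_series r 0 n).
Proof.
rewrite !(@partition_seriesE n.+1 n.+1) //.
have E := @emoment_colS _ _ _ F0 q_neq0 t_neq0 qt_gen n.+1 n.+1 r n.
rewrite mulrCA E // !addn0.
set a := emoment _ _ _ _ _ _ _; set b := emoment _ _ _ _ _ _ _.
rewrite [h ^+ r.+1]exprS [(-1) ^+ r.+1]exprS.
have u0 : t ^+ r != 0 by rewrite expf_neq0.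
set v := h ^+ r; have v0 : v != 0 by rewrite expf_neq0.
set u := t ^+ r in u0 *; rewrite /t; field.
by rewrite v0 u0 h_neq0.
Qed.

Lemma partition_series_comm0 r s :
  (t ^+ r.+1 - 1) * partition_series r.+1 s 0 =
  (t ^+ s.+1 - 1) * partition_series r s.+1 0.
Proof.
rewrite !(@partition_seriesE 0 0) // addnS addSn !(mulrCA (_ - 1)).
congr (_ * _); apply/eqP; rewrite -subr_eq0.
by rewrite (emoment_comm0 F0 q_neq0 t_neq0 qt_gen).
Qed.

Lemma partition_series_commS r s n :
  (t ^+ r.+1 - 1) * partition_series r.+1 s n.+1
  - (t ^+ s.+1 - 1) * partition_series r s.+1 n.+1
  = - h * q * (t ^- r - t ^- s) * partition_series r s n.
Proof.
rewrite !(@partition_seriesE n.+1 n.+1) // addnS addSn !(mulrCA (_ - 1)) -mulrBr.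
rewrite (emoment_commS F0 q_neq0 t_neq0 qt_gen) //.
set a := emoment _ _ _ _ _ _ _.
rewrite [h ^+ _.+1]exprS [(-1) ^+ _.+1]exprS.
have v0 : h ^+ (r + s) != 0 by rewrite expf_neq0.
set v := h ^+ (r + s) in v0 *.
set x := t ^- r; set y := t ^- s; rewrite /t; field.
by rewrite v0 h_neq0.
Qed.

End Series.

(** * Elementary symmetric polynomials and q-binomial recurrences *)

Section ElementarySums.

Variable F : fieldType.
Implicit Types (u : nat -> F) (c : F).

Definition elsym N u r : F := (\prod_(i < N) fac (- u i))`_r.

Lemma eq_elsym N u u' r : (forall i, (i < N)%N -> u i = u' i) ->
  elsym N u r = elsym N u' r.
Proof.
move=> uu'; rewrite /elsym (eq_bigr (fun i : 'I_N => fac (- u' i))) // => i _.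
by rewrite uu'.
Qed.

Lemma elsym0 N u : elsym N u 0 = 1.
Proof.
rewrite /elsym -horner_coef0 horner_prod big1 // => i _.
by rewrite horner_fac mulr0 subr0.
Qed.

Lemma elsymS N u r : elsym N.+1 u r.+1 = elsym N u r.+1 + u N * elsym N u r.
Proof. by rewrite /elsym big_ord_recr /= mulrC coefS_fac mulNr opprK. Qed.

Lemma elsym_gt N u r : (N < r)%N -> elsym N u r = 0.
Proof.
move=> lt_Nr; apply: nth_default; apply: leq_trans (size_prod_fac _ _ _) _.
by rewrite -sum1_count sum1_card card_ord.
Qed.

Lemma elsym_rev N u r : elsym N u r = elsym N (fun i => u (N - i.+1)%N) r.
Proof. by rewrite /elsym (reindex_inj rev_ord_inj). Qed.

Lemma dil_fac c (x : F) : dil c (fac x) = fac (c * x).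
Proof.
apply/polyP => -[|[|k]]; rewrite coef_dil !coefB !coefZ !coef1 !coefX /=; ring.
Qed.

Lemma dil_prod_fac c (I : finType) (x : I -> F) :
  dil c (\prod_i fac (x i)) = \prod_i fac (c * x i).
Proof.
by rewrite /dil rmorph_prod; apply: eq_bigr => i _; apply: dil_fac.
Qed.

Lemma elsym_scale c N u r : elsym N (fun i => c * u i) r = c ^+ r * elsym N u r.
Proof.
rewrite /elsym -coef_dil dil_prod_fac.
by under [in RHS]eq_bigr => i _ do rewrite mulrN.
Qed.

Lemma elsymE N u r : elsym N u r =
  \sum_(A : {set 'I_N} | #|A| == r) \prod_(i in A) u i.
Proof.
rewrite /elsym; under eq_bigr => i _ do rewrite /fac scaleNr opprK addrC.
rewrite bigA_distr coef_sum [RHS]big_mkcond; apply: eq_bigr => A _.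
rewrite -big_mkcond /= scaler_prod prodr_const coefZ coefXn eq_sym.
by case: eqP; rewrite ?mulr1 ?mulr0.
Qed.

Lemma elsymS_lowest (t : F) N u r : t != 0 ->
  t ^- (r.+1 * r)./2 * elsym N.+1 (fun i => u i * t ^+ i) r.+1 =
  t ^- (r.+1 * r)./2 * elsym N (fun i => u i * t ^+ i) r.+1
  + u N * t ^+ (N - r) * (t ^- (r * r.-1)./2 * elsym N (fun i => u i * t ^+ i) r).
Proof.
move=> t0; rewrite elsymS mulrDr; congr (_ + _).
have [le_rN|lt_Nr] := leqP r N; last by rewrite elsym_gt // !mulr0.
have -> : t ^- (r.+1 * r)./2 = t ^- r * t ^- (r * r.-1)./2.
  by rewrite -[r in (_ * r)%N]/(r.+1.-1) -!bin2 binS bin1 exprD invfM mulrC.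
have -> : t ^+ N = t ^+ (N - r) * t ^+ r by rewrite -exprD subnK.
have : t ^+ r != 0 by rewrite expf_neq0.
set e := elsym _ _ _; set b := (t ^+ (_./2))^-1; set v := t ^+ r.
by move=> v0; field.
Qed.

End ElementarySums.

Section QBinomial.

Variables (F : fieldType) (q t : F) (N : nat).

Definition shifted_row r i : F := q ^+ (i < r) * t ^+ (N - i.+1).

(** Compare coefficients in (1 + c z) B(t z) = (1 + c t^N z) B(z). *)
Lemma elsym_geom c s :
  (t ^+ s.+1 - 1) * elsym N (fun i => c * t ^+ (N - i.+1)) s.+1 =
  c * (t ^+ N - t ^+ s) * elsym N (fun i => c * t ^+ (N - i.+1)) s.
Proof.
pose B := \prod_(i < N) fac (- (c * t ^+ (N - i.+1))).
have : fac (- c) * dil t B = fac (- (c * t ^+ N)) * B.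
  rewrite /B dil_prod_fac; case: N => [|n].
    by rewrite !big_ord0 expr0 !mulr1.
  rewrite [in LHS]big_ord_recl [in RHS]big_ord_recr /= subnn expr0 mulr1.
  rewrite mulrCA [X in _ = _ * X]mulrC; congr (_ * (_ * _)).
    by rewrite mulrN mulrCA -exprS subn1.
  apply: eq_bigr => i _; rewrite /bump /= add1n mulrN mulrCA -exprS.
  by congr (fac (- (_ * _ ^+ _))); have := ltn_ord i; lia.
move=> /(congr1 (fun f : {poly F} => f`_s.+1)); rewrite !coefS_fac !coef_dil.
rewrite -/(elsym N (fun i => c * t ^+ (N - i.+1)) s.+1).
rewrite -/(elsym N (fun i => c * t ^+ (N - i.+1)) s) => e.
apply/eqP; rewrite -subr_eq0; apply/eqP.
move/eqP: e; rewrite -subr_eq0 => /eqP <-.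
by ring.
Qed.

Let P r := \prod_(i < N) fac (- shifted_row r i).

Let P_exchange r : (r < N)%N ->
  fac (- t ^+ (N - r.+1)) * P r.+1 = fac (- (q * t ^+ (N - r.+1))) * P r.
Proof.
move=> lt_rN; pose j := Ordinal lt_rN; rewrite /P [in LHS](bigD1 j) // [in RHS](bigD1 j) //=.
rewrite /shifted_row ltnSn ltnn mul1r expr1.
rewrite mulrCA; congr (_ * (_ * _)); apply: eq_bigr => i.
rewrite -val_eqE /= => ne; congr (fac (- (q ^+ _ * _))).
by rewrite ltnS leq_eqVlt (negbTE ne).
Qed.

Let P_shift r : (r < N)%N ->
  fac (- 1) * dil t (P r.+1) = fac (- (q * t ^+ N)) * P r.
Proof.
rewrite /P /shifted_row dil_prod_fac; case: N => // n; rewrite ltnS => le_rn.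
rewrite [in LHS]big_ord_recl [in RHS]big_ord_recr /= subnn ltnNge le_rn mul1r expr0.
rewrite mulrCA [X in _ = _ * X]mulrC; congr (_ * (_ * _)).
  by rewrite expr1 mulrN mulrCA -exprS subn1.
apply: eq_bigr => i _; rewrite /bump /= add1n ltnS mulrN mulrCA -exprS.
by congr (fac (- (_ * _ ^+ _))); have := ltn_ord i; lia.
Qed.

(** For r < N, [P_exchange] and [P_shift] both relate [P r.+1] to [P r]; eliminating the top
    coefficient of [P r.+1] gives the formula. For r = N it reduces to [elsym_geom]. *)
Lemma elsym_shifted r s : (r <= N)%N ->
  (t ^+ s.+1 - 1) * elsym N (shifted_row r) s.+1 =
  (t ^+ (N - r + s) - t ^+ s) * elsym N (shifted_row r.+1) s
  - q * (t ^+ (N - r + s) - t ^+ N) * elsym N (shifted_row r) s.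
Proof.
rewrite leq_eqVlt => /orP[/eqP->|lt_rN].
  rewrite subnn add0n subrr mul0r add0r.
  have E k : elsym N (shifted_row N) k = elsym N (fun i => q * t ^+ (N - i.+1)) k.
    by apply: eq_elsym => i lt_iN; rewrite /shifted_row lt_iN.
  by rewrite !E elsym_geom; ring.
have := P_exchange lt_rN; have := P_shift lt_rN.
move=> /(congr1 (fun f : {poly F} => f`_s.+1)) e1.
move=> /(congr1 (fun f : {poly F} => f`_s.+1)); move: e1.
rewrite !coefS_fac !coef_dil -![(P _)`__]/(elsym N (shifted_row _) _) => e1 e2.
have -> : t ^+ (N - r + s) = t ^+ s.+1 * t ^+ (N - r.+1).
  by rewrite -exprD; congr (_ ^+ _); lia.
move/eqP: e2; rewrite -subr_eq0 => /eqP e2.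
move/eqP: e1; rewrite -subr_eq0 => /eqP e1.
move: e1 e2; set E1 := (X in X = 0); set E2 := (X in _ -> X = 0 -> _) => e1 e2.
apply/eqP; rewrite -subr_eq0; apply/eqP.
transitivity (E1 - t ^+ s.+1 * E2); last by rewrite e1 e2 mulr0 subr0.
by rewrite /E1 /E2 [t ^+ s.+1]exprS; ring.
Qed.

End QBinomial.

(** * The quotient as a polynomial in Q and its values at t^N *)

Section Quotient.

Variables (F : fieldType) (q h : F).
Hypotheses (F0 : [pchar F] =i pred0) (q_neq0 : q != 0) (h_neq0 : h != 0).
Let t : F := h ^+ 2.
Hypothesis qt_gen : forall a b : int, q ^ a * t ^ b = 1 -> a = 0 /\ b = 0.

Let t_neq0 : t != 0. Proof. exact: expf_neq0. Qed.

Let t_gen k : t ^+ k.+1 - 1 != 0.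
Proof.
rewrite subr_eq0; apply/eqP => tk.
by have [] := @qt_gen 0 k.+1; rewrite ?expr0z ?mul1r.
Qed.

Definition colnorm (r : nat) : F := (-1) ^+ r * t ^- (r * r.-1)./2.

Lemma colnormS r : colnorm r.+1 = - t ^- r * colnorm r.
Proof.
rewrite /colnorm -!bin2 binS bin1 exprS exprD invfM; ring.
Qed.

Definition column_value r s N : F :=
  colnorm r * colnorm s * (h ^+ r * elsym N (fun i => t ^+ i) r)
  * (h ^+ s * elsym N (shifted_row q t N r) s).

Lemma column_value00 N : column_value 0 0 N = 1.
Proof. by rewrite /column_value !elsym0 /colnorm /= invr1 !mulr1. Qed.

Let elsym_base r N : (t ^+ r.+1 - 1) * elsym N (fun i => t ^+ i) r.+1 =
  (t ^+ N - t ^+ r) * elsym N (fun i => t ^+ i) r.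
Proof.
have E k : elsym N (fun i => t ^+ i) k = elsym N (fun i => 1 * t ^+ (N - i.+1)) k.
  by rewrite elsym_rev; apply: eq_elsym => i _; rewrite mul1r.
by rewrite !E elsym_geom mul1r.
Qed.

Lemma column_value_col r N : (t ^+ r.+1 - 1) * column_value r.+1 0 N =
  h * (1 - t ^- r * t ^+ N) * column_value r 0 N.
Proof.
have e := elsym_base r N; rewrite /column_value !elsym0 colnormS.
move: e; set x := elsym _ _ _; set y := elsym _ _ _ => e.
transitivity (- t ^- r * colnorm r * colnorm 0 * h ^+ r.+1
  * ((t ^+ r.+1 - 1) * x)); first by ring.
rewrite e exprS; have : t ^+ r != 0 by rewrite expf_neq0.
set z := t ^+ r => z0; field.
exact: z0.
Qed.

Lemma column_value_step r s N : (t ^+ s.+1 - 1) * column_value r s.+1 N =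
  (t ^+ r.+1 - 1) * column_value r.+1 s N
  + h * q * (t ^- r - t ^- s) * t ^+ N * column_value r s N.
Proof.
have e := elsym_base r N; rewrite /column_value !colnormS.
(* If N < r every term vanishes; otherwise [N - r] is a true difference. *)
have [le_rN|lt_Nr] := leqP r N; last first.
  rewrite !(elsym_gt _ lt_Nr) (elsym_gt _ (ltnW lt_Nr : (N < r.+1)%N)).
  by rewrite !(mulr0, mul0r) addr0.
have e' := elsym_shifted q t s le_rN.
move: e e'; set x := elsym _ _ r.+1; set y := elsym _ _ r.
set x' := elsym _ _ s.+1; set y' := elsym _ (shifted_row _ _ _ r.+1) s.
set w' := elsym _ _ s => e e'.
have tN : t ^+ N = t ^+ (N - r) * t ^+ r by rewrite -exprD subnK.
transitivity (colnorm r * (- t ^- s * colnorm s) * (h ^+ r * y) * h ^+ s.+1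
  * ((t ^+ s.+1 - 1) * x')); first by ring.
rewrite e'; transitivity (- t ^- r * colnorm r * colnorm s * h ^+ r.+1 * (h ^+ s * y')
    * ((t ^+ r.+1 - 1) * x)
  + h * q * (t ^- r - t ^- s) * t ^+ N *
  (colnorm r * colnorm s * (h ^+ r * y) * (h ^+ s * w'))); last by ring.
rewrite e tN !exprS exprD; have : t ^+ r != 0 by rewrite expf_neq0.
have : t ^+ s != 0 by rewrite expf_neq0.
set z := t ^+ r; set z' := t ^+ s => z0 z0'; field.
by rewrite z0 z0'.
Qed.

(** The signs square to 1, and reversing the second list puts both in the form u_i t^i of
    [nonneg_elsym]. *)
Lemma column_value_sign r s N : (-1) ^+ (r + s) * column_value r s N =
  h ^+ (r + s) * (t ^- (r * r.-1)./2 * elsym N (fun i => 1 * t ^+ i) r)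
  * (t ^- (s * s.-1)./2 * elsym N (fun i => q ^+ (N - i.+1 < r)%N * t ^+ i) s).
Proof.
have sgn k : (-1) ^+ k * (-1) ^+ k = 1 :> F by rewrite -expr2 sqrr_sign.
have -> : elsym N (fun i => 1 * t ^+ i) r = elsym N (fun i => t ^+ i) r.
  by apply: eq_elsym => i _; rewrite mul1r.
have -> : elsym N (fun i => q ^+ (N - i.+1 < r)%N * t ^+ i) s =
    elsym N (shifted_row q t N r) s.
  rewrite [RHS]elsym_rev; apply: eq_elsym => i lt_iN.
  by rewrite /shifted_row; congr (_ * _ ^+ _); lia.
rewrite /column_value /colnorm !exprD.
set x := elsym _ _ r; set y := elsym _ _ s.
set b := t ^- _; set c := t ^- _; set u := h ^+ r; set v := h ^+ s.
have := sgn r; have := sgn s; set i := (-1) ^+ r; set j := (-1) ^+ s => jj ii.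
transitivity ((i * i) * (j * j) * (u * v * (b * x) * (c * y))); first by ring.
by rewrite ii jj !mul1r.
Qed.

Lemma column_value_eq0 r s N : (N < maxn r s)%N -> column_value r s N = 0.
Proof.
rewrite /column_value leq_max => /orP[lt|lt]; rewrite (elsym_gt _ lt) mulr0.
  by rewrite mulr0 mul0r.
by rewrite mulr0.
Qed.

Let Z r s := partition_series q h r s.

Let conv (P : {poly F}) n : F := \sum_(k < n.+1) P`_k * Z 0 0 (n - k).

Let convD P1 P2 n : conv (P1 + P2) n = conv P1 n + conv P2 n.
Proof. by rewrite -big_split; apply: eq_bigr => k _; rewrite coefD mulrDl. Qed.

Let convZ a P n : conv (a *: P) n = a * conv P n.
Proof. by rewrite mulr_sumr; apply: eq_bigr => k _; rewrite coefZ mulrA. Qed.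

Let convX0 P : conv ('X * P) 0 = 0.
Proof. by rewrite /conv big_ord1 coefXM mul0r. Qed.

Let convXS P n : conv ('X * P) n.+1 = conv P n.
Proof.
rewrite /conv big_ord_recl coefXM mul0r add0r; apply: eq_bigr => k _.
by rewrite coefXM /= /bump /= add1n subSS.
Qed.

Let quotient_col r : exists P : {poly F},
  (forall n, Z r 0 n = conv P n) /\ forall N, P.[t ^+ N] = column_value r 0 N.
Proof.
elim: r => [|r [P [PZ PN]]].
  exists 1; split=> [n|N]; last by rewrite column_value00 hornerC.
  rewrite /conv big_ord_recl coef1 mul1r subn0 big1 ?addr0 // => k _.
  by rewrite coef1 mul0r.
exists ((h / (t ^+ r.+1 - 1)) *: (P + (- t ^- r) *: ('X * P))); split=> [n|N].
  apply: (mulfI (t_gen r)); rewrite convZ convD convZ.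
  rewrite mulrA mulrCA divff // mulr1.
  case: n => [|n]; first by rewrite convX0 mulr0 addr0 -PZ partition_series_col0.
  by rewrite convXS -!PZ partition_series_colS // mulNr.
apply: (mulfI (t_gen r)); rewrite column_value_col hornerZ hornerD hornerZ hornerM.
rewrite hornerX PN mulrA mulrCA divff // mulr1.
by ring.
Qed.

(** The recurrence trades (r, s + 1) for (r + 1, s) and (r, s), so the induction is on s for all r,
    starting from the one-column case. *)
Lemma partition_series_quotient r s : exists P : {poly F},
  (forall n, Z r s n = conv P n) /\ forall N, P.[t ^+ N] = column_value r s N.
Proof.
elim: s r => [|s IH] r; first exact: quotient_col.
have [P1 [P1Z P1N]] := IH r.+1; have [P2 [P2Z P2N]] := IH r.
exists ((t ^+ s.+1 - 1)^-1 *: ((t ^+ r.+1 - 1) *: P1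
  + (h * q * (t ^- r - t ^- s)) *: ('X * P2))); split=> [n|N].
  apply: (mulfI (t_gen s)); rewrite convZ mulVKf // convD !convZ -P1Z.
  case: n => [|n].
    by rewrite convX0 mulr0 addr0 /Z partition_series_comm0.
  rewrite convXS -P2Z.
  have := partition_series_commS F0 q_neq0 h_neq0 qt_gen r s n.
  move/eqP; rewrite subr_eq => /eqP ->.
  by rewrite /Z /t; ring.
apply: (mulfI (t_gen s)); rewrite column_value_step hornerZ mulVKf //.
by rewrite hornerD !hornerZ hornerM hornerX P1N P2N !mulrA.
Qed.

Lemma partition_series00 : Z 0 0 0 != 0.
Proof.
rewrite /Z (@partition_seriesE _ _ _ F0 q_neq0 h_neq0 qt_gen 0 0) //.
rewrite !expr0 invr1 !mul1r /emoment /weighted_sum.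
rewrite (big_pred1 [ffun=> ord0]) => [|g]; last first.
  by rewrite big_ord0 eqxx; apply/esym/eqP/ffunP => -[].
by rewrite /weight big_ord0 !(ecoef0 _ _ F0) !mulr1 oner_neq0.
Qed.

End Quotient.

(** * Genericity of q and t, positivity, and the conclusion *)

Lemma monomial_inj_int (F : fieldType) (x y : F) : x != 0 -> y != 0 ->
  (forall a a' b b', x ^+ a * y ^+ b = x ^+ a' * y ^+ b' -> a = a' /\ b = b') ->
  forall a b : int, x ^ a * y ^ b = 1 -> a = 0 /\ b = 0.
Proof.
move=> x0 y0 xy_inj a b.
have inv c c' d d' : x ^+ c / x ^+ c' * (y ^+ d / y ^+ d') = 1 -> c = c' /\ d = d'.
  rewrite mulrACA -invfM => /(canRL (divfK _)); rewrite mul1r => e.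
  by apply: xy_inj; apply: e; rewrite mulf_neq0 ?expf_neq0.
case: a b => [a|a] [b|b] /= e.
- by have [] := inv a 0%N b 0%N; [rewrite !expr0 !divr1|move=> -> ->].
- by have [] := inv a 0%N 0%N b.+1; first by rewrite !expr0 divr1 div1r.
- by have [] := inv 0%N a.+1 b 0%N; first by rewrite !expr0 divr1 div1r.
- by have [] := inv 0%N a.+1 0%N b.+1; first by rewrite !expr0 !div1r.
Qed.

Lemma Kqt_pchar : [pchar Kqt] =i pred0.
Proof.
apply/pcharf0P => n.
rewrite -(rmorph_nat (@FracField.tofrac Zqt)) tofrac_eq0.
by rewrite -polyC_natr polyC_eq0 -polyC_natr polyC_eq0 pnatr_eq0.
Qed.

Lemma q_neq0 : q != 0.
Proof. by rewrite /q tofrac_eq0 polyC_eq0 polyX_eq0. Qed.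

Lemma sqrt_t_neq0 : sqrt_t != 0.
Proof. by rewrite /sqrt_t tofrac_eq0 polyX_eq0. Qed.

Lemma qt_monomial_inj a a' b b' :
  q ^+ a * t ^+ b = q ^+ a' * t ^+ b' -> a = a' /\ b = b'.
Proof.
rewrite /q /t /sqrt_t -!exprM -!rmorphXn -!rmorphM => /eqP.
rewrite tofrac_eq => /eqP e.
have {}e : ('X^a : {poly int})%:P * 'X^(2 * b) =
  ('X^a' : {poly int})%:P * 'X^(2 * b') :> Zqt := e.
have nz k : ('X^k : {poly int})%:P != 0 :> Zqt.
  by rewrite polyC_eq0 monic_neq0 ?monicXn.
have bb : b = b'.
  move/(congr1 (fun p : Zqt => size p)): e.
  rewrite !size_mulXn // !size_polyC !(monic_neq0 (monicXn _ _)).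
  by move=> ?; lia.
move: e; rewrite bb => /(mulIf (monic_neq0 (monicXn _ _))) /polyC_inj.
by move=> /(congr1 (fun p : {poly int} => size p)); rewrite !size_polyXn => -[->].
Qed.

Lemma qt_generic (a b : int) : q ^ a * t ^ b = 1 -> a = 0 /\ b = 0.
Proof.
apply: monomial_inj_int; first exact: q_neq0; last exact: qt_monomial_inj.
exact: expf_neq0 2 sqrt_t_neq0.
Qed.

Lemma elem_symE N r y : elem_sym N r y = elsym N (fun i => y i.+1) r.
Proof.
rewrite elsymE /elem_sym /mesym raddf_sum /=; apply: eq_bigr => A _.
by rewrite rmorph_prod; apply: eq_bigr => i _; rewrite /= mevalXU.
Qed.

Lemma nonneg_int_polyD x y : nonneg_int_poly x -> nonneg_int_poly y ->
  nonneg_int_poly (x + y).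
Proof.
move=> [f -> f0] [g -> g0]; exists (f + g); first by rewrite rmorphD.
by move=> i j; rewrite !coefD addr_ge0.
Qed.

Lemma nonneg_int_polyM x y : nonneg_int_poly x -> nonneg_int_poly y ->
  nonneg_int_poly (x * y).
Proof.
move=> [f -> f0] [g -> g0]; exists (f * g); first by rewrite rmorphM.
move=> i j; rewrite coefM coef_sum sumr_ge0 // => k _.
by rewrite coefM sumr_ge0 // => l _; rewrite mulr_ge0.
Qed.

Lemma nonneg_int_poly0 : nonneg_int_poly 0.
Proof. by exists 0 => [|i j]; rewrite ?rmorph0 // !coef0. Qed.

Lemma nonneg_int_poly1 : nonneg_int_poly 1.
Proof.
exists 1 => [|i j]; first by rewrite rmorph1.
by rewrite coef1; case: eqP => _; rewrite ?coef1 ?coef0 //; case: eqP.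
Qed.

Lemma nonneg_int_polyX x n : nonneg_int_poly x -> nonneg_int_poly (x ^+ n).
Proof.
move=> x0; elim: n => [|n IH]; first exact: nonneg_int_poly1.
by rewrite exprS; apply: nonneg_int_polyM.
Qed.

Lemma nonneg_q : nonneg_int_poly q.
Proof.
exists ('X : {poly int})%:P => // i j; rewrite coefC.
by case: eqP => _; rewrite ?coefX ?coef0 //; case: eqP.
Qed.

Lemma nonneg_sqrt_t : nonneg_int_poly sqrt_t.
Proof.
exists 'X => // i j; rewrite coefX.
by case: eqP => _; rewrite ?coef1 ?coef0 //; case: eqP.
Qed.

(* The lowest power of t in e_r(u_0, u_1 t, u_2 t^2, ...) is t^(r(r-1)/2).    *)
Lemma nonneg_elsym (u : nat -> Kqt) N r : (forall i, nonneg_int_poly (u i)) ->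
  nonneg_int_poly (t ^- (r * r.-1)./2 * elsym N (fun i => u i * t ^+ i) r).
Proof.
move=> u0; have t0 : t != 0 := expf_neq0 2 sqrt_t_neq0.
elim: N r => [|N IH] [|r].
- by rewrite elsym0 expr0 invr1 mul1r; apply: nonneg_int_poly1.
- by rewrite elsym_gt // mulr0; apply: nonneg_int_poly0.
- by rewrite elsym0 expr0 invr1 mul1r; apply: nonneg_int_poly1.
rewrite elsymS_lowest //; apply: nonneg_int_polyD; first exact: IH.
apply: nonneg_int_polyM; last exact: IH.
by apply/nonneg_int_polyM/nonneg_int_polyX/nonneg_int_polyX/nonneg_sqrt_t.
Qed.

Theorem proposition4p6 (r s : nat) :
  exists2 P : {poly Kqt},
    fps_quotient_is (Zseries (onecol r) (onecol s)) (Zseries [::] [::]) P &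
    forall N : nat,
      [/\ (-1) ^+ (r + s) * P.[t ^+ N] =
            (-1) ^+ (r + s) * g_col s * g_col r
            * elem_sym N r (fun i => sqrt_t ^ (2 * i%:Z - 1))
            * elem_sym N s (fun i => q ^+ part (onecol r) i
                                 * sqrt_t ^ (2 * N%:Z + 1 - 2 * i%:Z)),
          nonneg_int_poly ((-1) ^+ (r + s) * P.[t ^+ N]) &
          (N < maxn r s)%N -> (-1) ^+ (r + s) * P.[t ^+ N] = 0].
Proof.
have h0 := sqrt_t_neq0; have q0 := q_neq0; have F0 := Kqt_pchar.
have [P [PZ PN]] := partition_series_quotient F0 q0 h0 qt_generic r s.
exists P; first by split; [exact: (partition_series00 F0 q0 h0 qt_generic)|].
have {}PN N : P.[t ^+ N] = column_value q sqrt_t r s N := PN N.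
have e1 N : elem_sym N r (fun i => sqrt_t ^ (2 * i%:Z - 1)) =
    sqrt_t ^+ r * elsym N (fun i => t ^+ i) r.
  rewrite elem_symE -elsym_scale; apply: eq_elsym => i _.
  rewrite /t -exprM -exprS exprnP; congr (_ ^ _); lia.
have e2 N : elem_sym N s (fun i => q ^+ part (onecol r) i
      * sqrt_t ^ (2 * N%:Z + 1 - 2 * i%:Z)) =
    sqrt_t ^+ s * elsym N (shifted_row q t N r) s.
  rewrite elem_symE -elsym_scale; apply: eq_elsym => i lt_iN.
  rewrite /shifted_row /part /onecol nth_nseq /= mulrCA.
  have -> : (if (i < r)%N then 1%N else 0%N) = (i < r)%N by case: ifP.
  congr (_ * _); rewrite /t -exprM -exprS exprnP; congr (_ ^ _); lia.
move=> N; split.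
- rewrite PN e1 e2 -!mulrA; congr (_ * _).
  by rewrite /column_value -!mulrA -/t !(mulrA (_ ^+ _) (t ^- _)) mulrCA.
- rewrite PN (column_value_sign q0 h0).
  apply: nonneg_int_polyM; [apply: nonneg_int_polyM|].
  - by apply/nonneg_int_polyX/nonneg_sqrt_t.
  - by apply: nonneg_elsym => i; apply: nonneg_int_poly1.
  - by apply: nonneg_elsym => i; apply/nonneg_int_polyX/nonneg_q.
- by move=> lt_N; rewrite PN column_value_eq0 ?mulr0.
Qed.
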